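(* If the entire function $f\in\mathcal K$ has finite order and has one Borel exceptional value, then $f$ is a clan.
   Context: $\mathcal K$ is the class of non-constant power series $f(z)=\sum_{n\ge0}a_nz^n$ with positive radius of convergence, with $a_n\ge 0$ for all $n$ and $a_0>0$; here $f$ is entire. The Khinchin family of $f$ is the family of random variables $(X_t)_{t\ge0}$ with values in $\{0,1,2,\dots\}$ given by $\mathbf P(X_t=n)=a_nt^n/f(t)$ for $t>0$, and $X_0\equiv0$. Write $m_f(t)=\mathbf E(X_t)=tf'(t)/f(t)$ and $\sigma_f^2(t)=\mathbf V(X_t)=t\,m_f'(t)$, $\sigma_f(t)\ge0$. An entire $f\in\mathcal K$ is a clan if $\lim_{t\to\infty}\sigma_f(t)/m_f(t)=0$. The order of an entire function $f$ is $\limsup_{t\to\infty}\frac{\ln\ln\max_{|z|=t}|f(z)|}{\ln t}$. A number $a\in\mathbb C$ is a Borel exceptional value of an entire function $f$ of finite order if the exponent of convergence of the $a$-values of $f$ (the zeros of $f(z)-a$, counted with multiplicity; the exponent is $0$ if there are finitely many) is strictly smaller than the order of $f$. *)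

(* Defs.v *)
From HB Require Import structures.
From mathcomp Require Import all_boot all_order all_algebra.
From mathcomp Require Import all_classical all_reals all_analysis.
From mathcomp Require Import complex.

Set Implicit Arguments.
Unset Strict Implicit.
Unset Printing Implicit Defensive.

Import Order.TTheory GRing.Theory Num.Theory.
Import numFieldNormedType.Exports.

Local Open Scope classical_set_scope.
Local Open Scope ring_scope.
Local Open Scope complex_scope.

(* The norm topology and the R[i]-normed module structure are found on the
   alias R[i]^o, not on R[i] itself. *)
Notation cplx R := (R[i]^o).

Definition modulus (R : realType) (z : cplx R) : R := ComplexField.Normc.normc z.

(* A power series is given by its coefficients; the supremum over real r >= 0
   of the points of convergence is the usual radius of convergence. *)
Definition cvg_radius (R : realType) (a : R^nat) : \bar R :=
  ereal_sup [set r%:E | r in [set r : R | 0 <= r /\ cvgn (pseries a r)]].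

Definition classK (R : realType) (a : R^nat) : Prop :=
  [/\ forall n, 0 <= a n, 0 < a 0%N, exists2 n, (0 < n)%N & a n != 0
    & (0 < cvg_radius a)%E].

Definition entire (R : realType) (a : R^nat) : Prop := cvg_radius a = +oo%E.

Definition psum (R : realType) (a : R^nat) (z : cplx R) : cplx R :=
  limn (series (fun n => (a n)%:C * z ^+ n : cplx R)).

Definition khinchin_pmf (R : realType) (a : R^nat) (t : R) (n : nat) : R :=
  a n * t ^+ n / limn (pseries a t).

(* The law of X_t on nat; it is the point mass at 0 for t = 0, and also, as a
   dummy value, when t lies outside the domain of convergence. *)
Definition khinchin_law (R : realType) (a : R^nat) (t : R) : set nat -> \bar R :=
  fun U => if `[< [/\ classK a, 0 < t & cvgn (pseries a t)] >]
           then (\esum_(n in U) (khinchin_pmf a t n)%:E)%E else \d_0%N U.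

Section khinchin_law_probability.
Context (R : realType) (a : R^nat) (t : R).
Local Open Scope ereal_scope.

Local Notation law := (khinchin_law a t).

Lemma pseries_sum_gt0 : classK a -> (0 < t)%R -> cvgn (pseries a t) ->
  (0 < limn (pseries a t))%R.
Proof.
move=> [age0 a0 _ _] t0 cvgat; apply: (lt_le_trans a0).
have nd : nondecreasing_seq (pseries a t).
  by apply: nondecreasing_series => i _ _; rewrite mulr_ge0// exprn_ge0// ltW.
have := nondecreasing_cvgn_le nd cvgat 1%N.
by rewrite /pseries /series/= big_nat1 expr0 mulr1.
Qed.

Lemma khinchin_pmf_ge0 n : classK a -> (0 < t)%R -> cvgn (pseries a t) ->
  (0 <= khinchin_pmf a t n)%R.
Proof.
move=> Ka t0 cvgat; have f0 := pseries_sum_gt0 Ka t0 cvgat.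
case: Ka => age0 _ _ _.
by rewrite /khinchin_pmf divr_ge0 ?(ltW f0)// mulr_ge0// exprn_ge0// ltW.
Qed.

Let law0 : law set0 = 0.
Proof.
by rewrite /khinchin_law measure0; case: ifPn => //; rewrite esum_set0.
Qed.

Let law_ge0 U : 0 <= law U.
Proof.
rewrite /khinchin_law; case: ifPn => // /asboolP[Ka t0 cvgat].
by apply: esum_ge0 => n _; rewrite lee_fin khinchin_pmf_ge0.
Qed.

Let law_sigma_additive : semi_sigma_additive law.
Proof.
move=> F mF tF mUF; rewrite /khinchin_law; case: ifPn => [/asboolP H|_]; last first.
  exact: measure_semi_sigma_additive.
case: H => Ka t0 cvgat.
have p0 k : 0 <= (khinchin_pmf a t k)%:E by rewrite lee_fin khinchin_pmf_ge0.
apply: cvg_toP.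
  apply: ereal_nondecreasing_is_cvgn => m n mn.
  by apply: lee_sum_nneg_natr => // k _ _; exact: esum_ge0.
by rewrite nneseries_sum_bigcup.
Qed.

HB.instance Definition _ := isMeasure.Build _ _ _ law
  law0 law_ge0 law_sigma_additive.

Let law_setT : law [set: nat] = 1.
Proof.
rewrite /khinchin_law; case: ifPn => [/asboolP[Ka t0 cvgat]|_]; last first.
  by rewrite probability_setT.
have f0 := pseries_sum_gt0 Ka t0 cvgat.
rewrite -nneseries_esumT; last first.
  by move=> n; rewrite lee_fin khinchin_pmf_ge0.
rewrite (_ : (fun n => _) = EFin \o ((limn (pseries a t))^-1 \*: pseries a t)%R).
  rewrite EFin_lim; last exact: is_cvgZr.
  by rewrite limZr// /GRing.scale/= mulVf// gt_eqF.
apply/funext => n /=; rewrite sumEFin; congr EFin.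
rewrite /pseries /series /= /GRing.scale/= mulr_sumr.
by apply: eq_bigr => k _; rewrite mulrC.
Qed.

HB.instance Definition _ :=
  @Measure_isProbability.Build _ _ R law law_setT.

End khinchin_law_probability.

Definition khinchin_mean (R : realType) (a : R^nat) (t : R) : R :=
  fine (expectation (khinchin_law a t) (fun n => n%:R)).

Definition khinchin_var (R : realType) (a : R^nat) (t : R) : R :=
  fine (variance (khinchin_law a t) (fun n => n%:R)).

Definition khinchin_std (R : realType) (a : R^nat) (t : R) : R :=
  Num.sqrt (khinchin_var a t).

Definition clan (R : realType) (a : R^nat) : Prop :=
  khinchin_std a t / khinchin_mean a t @[t --> +oo] --> (0 : R).

Definition max_modulus (R : realType) (f : cplx R -> cplx R) (t : R) : R :=
  sup [set modulus (f z) | z in [set z | modulus z = t]].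

Definition growth_order (R : realType) (f : cplx R -> cplx R) : \bar R :=
  limf_esup (fun t : R => (ln (ln (max_modulus f t)) / ln t)%:E) (pinfty_nbhs R).

(* The b-values of f other than 0, with multiplicity: a zero z of f - b of
   multiplicity m is listed as the m pairs (z, 0), ..., (z, m - 1). *)
Definition bvalues (R : realType) (f : cplx R -> cplx R) (b : cplx R) :
    set (cplx R * nat) :=
  [set p | p.1 != 0 /\ forall j, (j <= p.2)%N ->
     derive1n j (fun z => f z - b : cplx R) p.1 = 0].

Definition convergence_exponent (R : realType) (f : cplx R -> cplx R)
    (b : cplx R) : \bar R :=
  ereal_inf [set s%:E | s in [set s : R | 0 < s /\
    (\esum_(p in bvalues f b) (modulus p.1 `^ (- s))%:E < +oo)%E]].

Definition borel_exceptional (R : realType) (f : cplx R -> cplx R)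
    (b : cplx R) : Prop :=
  (convergence_exponent f b < growth_order f)%E.

(* Main.v *)
(** Let [f] have nonnegative coefficients and let [g = f - b] have zeros with
    [sum |z_j|^-s < oo], where [s] is smaller than the order of [f]. Hadamard's
    theorem says that [g = P exp Q] with [Q] a polynomial of degree [q > s] and
    [log |P|] of growth [O(r^s)]; hence [ln f(t) ~ A t^q]. This already forces the
    clan property: [E(lambda^X_t) = f(lambda t) / f(t)], so Chernoff's bound
    concentrates [X_t] exponentially around [q A t^q].

    Hadamard's theorem is bypassed by working with the partial sums [G_N] of the
    power series of [g] (divided by a power of [z]), which split into linear
    factors. Fix [r] and replace each factor [1 - z / w] with [|w| < r] by the
    Blaschke factor of the same modulus on [|z| = r]. The resulting polynomial
    [h_N] dominates [|G_N|] in the disk and is bounded there by the maximum of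
    [|G_N|] on [|z| = r]. Expanding [ln |1 - z / w|] for [|z| <= (1 - e) r] gives
    [ln |h_N(z)| = Re Q(z) + O(r^s)], with [Q] independent of [r] in the limit of
    large [N]. So [Re Q - O(r^s)] is a lower bound for [ln f(r)] and
    [Re Q + O(r^s)] an upper bound for [ln |g|], both on [|z| = (1 - e) r].

    The limits in [N] are taken along a nonprincipal ultrafilter. The only
    information about the zeros of [g] which is needed is semicontinuity: the
    roots of [G_N] in a disk converge to zeros of [g], with at most the same
    multiplicity, which follows from Cauchy's estimates for polynomials. *)

Require Import Defs.
From mathcomp Require Import all_boot all_order all_algebra.
From mathcomp Require Import all_classical all_reals all_analysis.
From mathcomp Require Import complex.
From mathcomp Require Import ring lra zify.
From mathcomp Require Import cyclic separable cyclotomic.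

Set Implicit Arguments.
Unset Strict Implicit.
Unset Printing Implicit Defensive.

Import Order.TTheory GRing.Theory Num.Theory.
Import numFieldNormedType.Exports.

Local Open Scope classical_set_scope.
Local Open Scope ring_scope.
Local Open Scope complex_scope.

(** Truncations make every product over roots finite, but far away their roots need bear no relation
    to the zeros of [g]: the hypothesis on the zeros controls, for each fixed radius, only a set of
    indices [N] that depends on that radius. Remote roots are therefore handled by Jensen's
    inequality and the finite order, with a crude integer exponent [H]. The sharp exponent [s] is
    recovered through Newton's identities: the sum of [w ^- k] over all roots depends only on the
    first coefficients, hence is eventually constant in [N]. For [k <= s] this bounds the sum over
    the remote roots well enough for the term of degree [k] to be dropped, so [Q] only has terms of
    degree above [s]. If there are none, [ln f(t) = O(t^s)], which contradicts the order. Since the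
    coefficients are nonnegative, [f(t)] is the maximum modulus. The upper bound is then taken at
    [z = t] and the lower bound in the direction where the leading term of [Re Q] is largest; both
    give the same [A], whatever the argument of the leading coefficient. The loss of the factor
    [1 - e] in the lower bound disappears because [e] is arbitrary. *)

Local Notation normc := ComplexField.Normc.normc.

Local Notation Re := complex.Re.
Local Notation Im := complex.Im.

(** * Polynomials and the complex modulus *)

Section modulus_lemmas.
Variable R : realType.
Implicit Types (z w : R[i]) (x : R).
Import ComplexField.

Lemma normcE z : normc z = Num.sqrt (Re z ^+ 2 + Im z ^+ 2).
Proof. by case: z. Qed.

Lemma normc_ge0 z : 0 <= normc z.
Proof. by rewrite normcE sqrtr_ge0. Qed.

Lemma sqr_normcE z : normc z ^+ 2 = Re z ^+ 2 + Im z ^+ 2.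
Proof. by rewrite normcE sqr_sqrtr// addr_ge0 ?sqr_ge0. Qed.

Lemma normcD z w : normc (z + w) <= normc z + normc w.
Proof. exact: (@le_normcD R). Qed.

Lemma normcN z : normc (- z) = normc z.
Proof. by case: z => a b; rewrite /= !sqrrN. Qed.

Lemma normcB z w : normc (z - w) = normc (w - z).
Proof. by rewrite -opprB normcN. Qed.

Lemma normcM z w : normc (z * w) = normc z * normc w.
Proof. exact: Normc.normcM. Qed.

Lemma normcV z : normc z^-1 = (normc z)^-1.
Proof. exact: Normc.normcV. Qed.

Lemma normc0 : normc (0 : R[i]) = 0.
Proof. by rewrite /= !expr0n/= addr0 sqrtr0. Qed.

Lemma normc1 : normc (1 : R[i]) = 1.
Proof. by rewrite /= expr0n/= addr0 expr1n sqrtr1. Qed.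

Lemma normcX z n : normc (z ^+ n) = normc z ^+ n.
Proof. by elim: n => [|n IH]; rewrite ?normc1// !exprS normcM IH. Qed.

Lemma normc_real x : normc x%:C = `|x|.
Proof. by rewrite /= expr0n/= addr0 sqrtr_sqr. Qed.

Lemma normc_real_ge0 x : 0 <= x -> normc x%:C = x.
Proof. by move=> x0; rewrite normc_real ger0_norm. Qed.

Lemma normc_eq0 z : (normc z == 0) = (z == 0).
Proof.
by apply/eqP/eqP => [/(@Normc.eq0_normc R)//|->]; rewrite normc0.
Qed.

Lemma normc_gt0 z : (0 < normc z) = (z != 0).
Proof. by rewrite lt_def normc_ge0 andbT normc_eq0. Qed.

Lemma normc_sum (I : Type) (r : seq I) (P : pred I) (F : I -> R[i]) :
  normc (\sum_(i <- r | P i) F i) <= \sum_(i <- r | P i) normc (F i).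
Proof.
elim/big_rec2: _ => [|i x z _ IH]; first by rewrite normc0.
by rewrite (le_trans (normcD _ _))// lerD2l.
Qed.

Lemma normc_prod (I : Type) (r : seq I) (P : pred I) (F : I -> R[i]) :
  normc (\prod_(i <- r | P i) F i) = \prod_(i <- r | P i) normc (F i).
Proof.
by elim/big_rec2: _ => [|i x z _ IH]; rewrite ?normc1// normcM IH.
Qed.

Lemma normc_conj z : normc (z^*) = normc z.
Proof. by case: z => a b /=; rewrite sqrrN. Qed.

Lemma Re_le_normc z : `|Re z| <= normc z.
Proof. by rewrite normcE -sqrtr_sqr ler_wsqrtr// lerDl sqr_ge0. Qed.

Lemma Im_le_normc z : `|Im z| <= normc z.
Proof. by rewrite normcE -sqrtr_sqr ler_wsqrtr// lerDr sqr_ge0. Qed.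

Lemma normc_le_ReIm z : normc z <= `|Re z| + `|Im z|.
Proof.
rewrite normcE -(ler_pXn2r (n:=2))// ?nnegrE ?sqrtr_ge0 ?addr_ge0//.
rewrite sqr_sqrtr ?addr_ge0 ?sqr_ge0// sqrrD !real_normK ?num_real//.
by rewrite lerD2r lerDl mulrn_wge0 ?mulr_ge0.
Qed.

Lemma normc_sub_le z w : normc z - normc w <= normc (z - w).
Proof. by rewrite lerBlDr (le_trans _ (normcD _ _))// subrK. Qed.

Lemma normc_dist z w : `|normc z - normc w| <= normc (z - w).
Proof.
rewrite ler_norml normc_sub_le andbT lerNl opprB.
by rewrite normcB normc_sub_le.
Qed.

Lemma ReD z w : Re (z + w) = Re z + Re w.
Proof. by case: z; case: w. Qed.

Lemma ReN z : Re (- z) = - Re z.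
Proof. by case: z. Qed.

Lemma Re_sum (I : Type) (r : seq I) (P : pred I) (F : I -> R[i]) :
  Re (\sum_(i <- r | P i) F i) = \sum_(i <- r | P i) Re (F i).
Proof. by elim/big_rec2: _ => // i x z _ <-; rewrite ReD. Qed.

Lemma Re_realM x z : Re (x%:C * z) = x * Re z.
Proof. by case: z => a b; rewrite /= mul0r subr0. Qed.

End modulus_lemmas.

(** * Coefficient bounds and the maximum principle for polynomials *)

Section polynomial_maximum.
Variable R : realType.
Implicit Types (p : {poly R[i]}) (z w : R[i]) (r M : R).

Lemma primitive_root_exists n : (0 < n)%N ->
  exists w : R[i], n.-primitive_root w.
Proof.
move=> n0; have [rs Dp] := closed_field_poly_normal ('X^n - 1 : {poly R[i]}).
rewrite (monicP _) ?monicXnsubC// scale1r in Dp.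
have rn1 : all n.-unity_root rs.
  by apply/allP => z; rewrite -root_prod_XsubC -Dp.
have sz : (n < (size rs).+1)%N.
  by rewrite -(size_prod_XsubC rs id) -Dp size_XnsubC.
have [|w _ wP] := hasP (has_prim_root n0 rn1 _ sz); last by exists w.
by rewrite -separable_prod_XsubC -Dp separable_Xn_sub_1// pnatr_eq0 -lt0n.
Qed.

Lemma normc_unity_root n z : (0 < n)%N -> z ^+ n = 1 -> normc z = 1.
Proof.
move=> n0 zn; apply/eqP.
by rewrite -(@pexpr_eq1 _ _ n) ?normc_ge0// -normcX zn normc1.
Qed.

(* Averaging [p] over the [n]-th roots of unity isolates one coefficient. *)
Lemma poly_coef_bound p r M k : 0 < r ->
  (forall z, normc z = r -> normc p.[z] <= M) -> normc p`_k * r ^+ k <= M.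
Proof.
move=> r0 pM.
(* [n] exceeds [k] and every exponent occurring in [p], so no two exponents agree modulo [n]; the
   exponent [n - k] stands for [-k]. *)
pose n := (size p + k.+1)%N.
have n0 : (0 < n)%N by rewrite /n addnS.
have kn : (k < n)%N by rewrite /n; lia.
have spn : (size p <= n)%N by rewrite /n; lia.
have [w wP] := primitive_root_exists n0.
have w1 i : normc (w ^+ i) = 1.
  apply: (@normc_unity_root n) => //.
  by rewrite -exprM mulnC exprM (prim_expr_order wP) expr1n.
have sum0 j : (j < n)%N ->
    \sum_(i < n) (w ^+ i) ^+ (j + (n - k)) = if j == k then n%:R else 0.
  move=> jn; have -> : \sum_(i < n) (w ^+ i) ^+ (j + (n - k)) =
      \sum_(i < n) (w ^+ (j + (n - k))) ^+ i.
    by apply: eq_bigr => i _; rewrite -!exprM mulnC.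
  case: eqP => [->|jk].
    rewrite subnKC ?(ltnW kn)// (prim_expr_order wP).
    rewrite (eq_bigr (fun=> 1)) => [|i _]; last by rewrite expr1n.
    by rewrite sumr_const card_ord.
  set u := w ^+ _; have u1 : u != 1.
    rewrite /u -(prim_order_dvd wP); apply/negP => /dvdnP[[|[|q]]].
    - by move: kn; lia.
    - by move: jk jn kn; lia.
    - by move: jn kn; rewrite mulSn mulSn; lia.
  apply/eqP; rewrite -(mulrI_eq0 _ (mulfI (_ : u - 1 != 0))) ?subr_eq0//.
  by rewrite -subrX1 /u -exprM mulnC exprM (prim_expr_order wP) expr1n subrr.
have pE : \sum_(i < n) p.[r%:C * w ^+ i] * (w ^+ i) ^+ (n - k) =
    n%:R * (p`_k * r%:C ^+ k).
  under eq_bigr do rewrite (horner_coef_wide _ spn) mulr_suml.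
  rewrite exchange_big/= (bigD1 (Ordinal kn))//= [X in _ + X]big1.
    rewrite addr0.
    under eq_bigr do rewrite exprMn mulrA -mulrA -exprD.
    by rewrite -mulr_sumr sum0// eqxx mulrC.
  move=> j jk.
  under eq_bigr do rewrite exprMn mulrA -mulrA -exprD.
  by rewrite -mulr_sumr sum0// ifN ?mulr0.
have : normc (n%:R * (p`_k * r%:C ^+ k)) <= n%:R * M.
  rewrite -pE (le_trans (normc_sum _ _ _))//.
  have -> : n%:R * M = \sum_(i < n) M by rewrite sumr_const card_ord mulr_natl.
  apply: ler_sum => i _; rewrite normcM normcX w1 expr1n mulr1; apply: pM.
  by rewrite normcM w1 mulr1 normc_real_ge0// ltW.
have -> : (n%:R : R[i]) = (n%:R)%:C by rewrite rmorph_nat.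
rewrite 2!normcM normcX !normc_real_ge0 ?ler0n ?(ltW r0)//.
by rewrite ler_pM2l// ltr0n.
Qed.

Lemma expr_bounded_le1 (x B : R) : (forall n, x ^+ n <= B) -> x <= 1.
Proof.
move=> xB; rewrite leNgt; apply/negP => x1.
have d0 : 0 < x - 1 by rewrite subr_gt0.
have bern n : 1 + n%:R * (x - 1) <= x ^+ n.
  elim: n => [|n IH]; first by rewrite mul0r addr0 expr0.
  have x0 : 0 <= x by lra.
  rewrite exprS; apply: le_trans (ler_wpM2l x0 IH).
  by rewrite -natr1; have := mulr_ge0 (ler0n R n) (sqr_ge0 (x - 1)); lra.
have := le_trans (bern (Num.truncn (B / (x - 1))).+1) (xB _).
apply/negP; rewrite -ltNge.
rewrite ltr_wpDl// -ltr_pdivrMr//.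
by apply: truncnS_gt.
Qed.

(* Each coefficient of [p ^+ m] is at most [M ^+ m / r ^+ k]; summing the
   resulting geometric series and taking [m]-th roots gives [M] back. *)
Lemma poly_max_modulus p r M : 0 < r -> 0 < M ->
  (forall z, normc z = r -> normc p.[z] <= M) ->
  forall z, normc z <= r -> normc p.[z] <= M.
Proof.
move=> r0 M0 pM z; rewrite le_eqVlt => /orP[/eqP/pM//|zr].
set q := normc z / r.
have q0 : 0 <= q by rewrite divr_ge0 ?normc_ge0 ?ltW.
have q1 : q < 1 by rewrite ltr_pdivrMr// mul1r.
rewrite -[leRHS]mul1r -ler_pdivrMr//.
apply: (@expr_bounded_le1 _ ((1 - q)^-1)) => m.
rewrite expr_div_n ler_pdivrMr ?exprn_gt0// -normcX -horner_exp.
rewrite horner_coef (le_trans (normc_sum _ _ _))//.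
have ck k : normc ((p ^+ m)`_k * z ^+ k) <= M ^+ m * q ^+ k.
  rewrite normcM normcX /q expr_div_n mulrA ler_pdivlMr ?exprn_gt0//.
  rewrite mulrAC ler_wpM2r ?exprn_ge0 ?normc_ge0//.
  apply: poly_coef_bound => // u ur; rewrite horner_exp normcX.
  by rewrite lerXn2r ?nnegrE ?normc_ge0 ?(ltW M0)// pM.
apply: (le_trans (ler_sum _ (fun k _ => ck (val k)))).
rewrite -mulr_sumr mulrC ler_wpM2r ?exprn_ge0 ?(ltW M0)//.
rewrite -[leRHS]mul1r ler_pdivlMr ?subr_gt0// mulrC.
rewrite -opprB mulNr -subrX1 opprB lerBlDr lerDl exprn_ge0//.
Qed.

End polynomial_maximum.

(** * Taylor expansion of the logarithm of [|1 - v|] *)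

Section log_taylor.
Variable R : realType.
Implicit Types v : R[i].

Lemma Re_div_mul_normc (v w : R[i]) : w != 0 ->
  Re (v / w) * normc w ^+ 2 = Re v * Re w + Im v * Im w.
Proof.
move=> w0; rewrite sqr_normcE; have : v / w * w = v by rewrite divfK.
case: (v / w) => c d; case: v w {w0} => a b [e f]; rewrite /= => -[<- <-].
ring.
Qed.

Lemma normc_1B_ge (v : R[i]) : 1 - normc v <= normc (1 - v).
Proof. by rewrite -(normc1 R) normc_sub_le. Qed.

(* The derivative of the left-hand side along [x |-> x v] is the real part of
   [- v (x v)^p / (1 - x v)]. *)
Lemma ln_normc_taylor (p : nat) (e : R) v : 0 < e -> normc v <= 1 - e ->
  `|ln (normc (1 - v)) + \sum_(n < p) Re (v ^+ n.+1) / n.+1%:R|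
    <= normc v ^+ p.+1 / e.
Proof.
move=> e0 ve.
(* [Q] is [|1 - x v|^2] as a real polynomial in [x], so the mean value theorem on [[0, 1]] applies
   to [ln Q / 2] and no complex logarithm is involved. *)
pose Q : {poly R} := (1 - (Re v)%:P * 'X) ^+ 2 + ((Im v)%:P * 'X) ^+ 2.
pose S : {poly R} := \sum_(n < p) (Re (v ^+ n.+1) / n.+1%:R)%:P * 'X^(n.+1).
have QE x : Q.[x] = normc (1 - x%:C * v) ^+ 2.
  rewrite sqr_normcE /Q !hornerE; case: v {ve Q S} => a b /=.
  by ring.
have dist (x : R) : 0 <= x <= 1 -> e <= normc (1 - x%:C * v).
  move=> /andP[x0 x1]; rewrite (le_trans _ (normc_1B_ge _))//.
  rewrite normcM normc_real_ge0//; have := normc_ge0 v; nra.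
have Q0 (x : R) : 0 <= x <= 1 -> 0 < Q.[x].
  by move=> /dist ?; rewrite QE exprn_gt0// (lt_le_trans e0).
pose phi x := 2^-1 * ln Q.[x] + S.[x].
pose dphi x := 2^-1 * (Q.[x]^-1 * (Q^`()).[x]) + (S^`()).[x].
have dphiP (x : R) : 0 <= x <= 1 -> is_derive x 1 phi (dphi x).
  move=> x01; rewrite (_ : phi = 2^-1 *: (@ln R \o horner Q) + horner S)//.
  apply: is_deriveD; apply: is_deriveZ.
  apply: (@is_derive1_comp _ (@ln R) (horner Q)).
  exact/is_derive1_ln/Q0.
have [||c] := @MVT_segment R phi dphi 0 1 ler01.
- by move=> x; rewrite in_itv/= => /andP[/ltW x0 /ltW x1]; apply: dphiP; rewrite x0.
- apply: derivable_within_continuous => x; rewrite in_itv/= => x01.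
  by have [] := dphiP _ x01.
rewrite in_itv/= => c01; rewrite subr0 mulr1.
have S0 : S.[0] = 0.
  rewrite /S horner_sum big1// => i _.
  by rewrite hornerM hornerXn expr0n/= mulr0.
have S1 : S.[1] = \sum_(n < p) Re (v ^+ n.+1) / n.+1%:R.
  rewrite /S horner_sum; apply: eq_bigr => i _.
  by rewrite hornerM hornerXn expr1n mulr1 hornerC.
have -> : phi 0 = 0 by rewrite /phi S0 QE mul0r subr0 normc1 expr1n ln1 mulr0 addr0.
have -> : phi 1 = ln (normc (1 - v)) + \sum_(n < p) Re (v ^+ n.+1) / n.+1%:R.
  rewrite /phi S1 QE mul1r lnXn; last first.
    by apply: (lt_le_trans e0); apply: le_trans (normc_1B_ge v); lra.
  congr (_ + _); lra.
rewrite subr0 => ->.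
set u := c%:C * v; set w := 1 - u.
have [c0 c1] := andP c01.
have w0 : w != 0 by rewrite -normc_gt0 (lt_le_trans e0)// dist.
have -> : dphi c = Re (- (v * u ^+ p / w)).
  have -> : - (v * u ^+ p / w) = - (v / w) + \sum_(n < p) v * u ^+ n.
    rewrite -mulr_sumr.
    have -> : \sum_(n < p) u ^+ n = (1 - u ^+ p) / w.
      apply: (mulIf w0); rewrite divfK// mulrC.
      by rewrite /w -opprB mulNr -subrX1 opprB.
    by ring.
  rewrite ReD ReN Re_sum /dphi; congr (_ + _).
    have := Re_div_mul_normc v w0; rewrite -QE => E.
    have /lt0r_neq0 q0 := Q0 _ c01.
    apply: (mulIf q0); rewrite mulNr E mulrC.
    rewrite mulrCA mulVKf//.
    rewrite /Q /w /u !poly.derivCE !hornerE/=.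
    by case: (v) => a b /=; field.
  rewrite /S raddf_sum horner_sum; apply: eq_bigr => i _ /=.
  rewrite derivM derivC mul0r add0r derivXn hornerM hornerC hornerMn hornerXn/=.
  have -> : v * u ^+ i = (c ^+ i)%:C * v ^+ i.+1.
    by rewrite /u exprMn exprS rmorphXn mulrCA mulrA.
  rewrite Re_realM -mulr_natr; field.
  by rewrite addrC natr1 pnatr_eq0.
rewrite (le_trans (Re_le_normc _))// normcN 2!normcM normcV normcX.
rewrite exprS; apply: ler_pM; rewrite ?invr_ge0 ?normc_ge0//.
- by rewrite mulr_ge0 ?exprn_ge0 ?normc_ge0.
- rewrite ler_wpM2l ?normc_ge0// lerXn2r ?nnegrE ?normc_ge0//.
  by rewrite /u normcM normc_real_ge0// ler_piMl ?normc_ge0.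
- by rewrite lef_pV2 ?posrE ?dist// (lt_le_trans e0)// dist.
Qed.

End log_taylor.

(** * Products of linear factors *)

Section root_products.
Variable R : realType.
Implicit Types (ws : seq R[i]) (z w g : R[i]) (r M s e : R) (H p n : nat).

Definition root_prod ws : {poly R[i]} := \prod_(w <- ws) (1 - w^-1 *: 'X).

Lemma horner_root_prod ws z :
  (root_prod ws).[z] = \prod_(w <- ws) (1 - z / w).
Proof.
rewrite horner_prod; apply: eq_bigr => w _.
by rewrite !hornerE mulrC.
Qed.

Lemma root_prodP (G : {poly R[i]}) : G`_0 != 0 ->
  exists2 ws, 0 \notin ws & G = G`_0 *: root_prod ws.
Proof.
move=> G0; have [ws GE] := closed_field_poly_normal G.
have ws0 : 0 \notin ws.
  apply: contra G0 => ws0; rewrite GE coefZ -horner_coef0 horner_prod.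
  by rewrite (big_rem _ ws0)/= hornerXsubC subrr mul0r mulr0.
have rp0 : (root_prod ws)`_0 = 1.
  rewrite -horner_coef0 horner_root_prod big1// => w _.
  by rewrite mul0r subr0.
have E : \prod_(w <- ws) ('X - w%:P) =
    (\prod_(w <- ws) (- w)) *: root_prod ws.
  rewrite -mul_polyC rmorph_prod -big_split; apply: eq_big_seq => w wws /=.
  have w0 : w != 0 by apply: contraNneq ws0 => <-.
  rewrite mulrBr mulr1 mul_polyC scalerA mulNr divff// scaleN1r opprK.
  by rewrite polyCN addrC.
exists ws => //.
have -> : G`_0 = lead_coef G * \prod_(w <- ws) (- w).
  by rewrite {1}GE E scalerA coefZ rp0 mulr1.
by rewrite -scalerA -E.
Qed.

Lemma root_prod0 ws : (root_prod ws)`_0 = 1.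
Proof.
rewrite -horner_coef0 horner_root_prod big1// => w _.
by rewrite mul0r subr0.
Qed.

(* Newton's identities, in the form [a' = - a (sum_w w^-1 / (1 - w^-1 X))]
   modulo [X^m]. *)
Lemma root_prod_newton ws m : exists q,
  (root_prod ws)^`() = 'X^m * q -
    root_prod ws * \poly_(k < m) (\sum_(w <- ws) w ^- k.+1).
Proof.
elim: ws => [|w ws [q IH]].
  exists 0; rewrite mulr0 sub0r /root_prod big_nil.
  rewrite -[1]/(1%:P) derivC (_ : \poly_(_ < _) _ = 0) ?mulr0 ?oppr0//.
  by apply/polyP => i; rewrite coef_poly coef0 big_nil if_same.
have -> : root_prod (w :: ws) = (1 - w^-1 *: 'X) * root_prod ws.
  by rewrite /root_prod big_cons.
have -> : \poly_(k < m) (\sum_(v <- w :: ws) v ^- k.+1) =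
    \poly_(k < m) (w ^- k.+1) + \poly_(k < m) (\sum_(v <- ws) v ^- k.+1).
  by apply/polyP => i; rewrite coefD !coef_poly big_cons; case: ifP; rewrite ?addr0.
set T := \poly_(k < m) (\sum_(v <- ws) v ^- k.+1) in IH *.
have TwE : (1 - w^-1 *: 'X) * \poly_(k < m) (w ^- k.+1) =
    (w^-1)%:P - (w ^- m.+1) *: 'X^m.
  apply/polyP => i.
  rewrite mulrBl mul1r coefB -scalerAl coefZ coefXM coefB coefC coefZ coefXn !coef_poly.
  case: i => [|i] /=.
    rewrite mulr0 subr0; case: m {q IH T} => [|m]//=.
      by rewrite expr1 mulr1 subrr.
    by rewrite mulr0 subr0 expr1.
  rewrite sub0r.
  have [im|im|->] := ltngtP i.+1 m.
  - by rewrite mulr0 oppr0 -!exprVn -exprS subrr.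
  - by rewrite mulr0n !mulr0 subr0 oppr0.
  - by rewrite mulr1 ?sub0r -!exprVn -exprS.
exists ((1 - w^-1 *: 'X) * q - root_prod ws * (w ^- m.+1)%:P).
have dE : (1 - w^-1 *: 'X)^`() = - (w^-1)%:P :> {poly R[i]}.
  by rewrite derivB -polyC1 derivC derivZ derivX sub0r -mul_polyC mulr1.
rewrite derivM IH dE.
have -> : (1 - w^-1 *: 'X) * root_prod ws * (\poly_(k < m) (w ^- k.+1) + T) =
    root_prod ws * ((w^-1)%:P - (w ^- m.+1) *: 'X^m) +
    (1 - w^-1 *: 'X) * root_prod ws * T.
  by rewrite -TwE; ring.
by rewrite -!mul_polyC; ring.
Qed.

(** Comparing coefficients in Newton's identities expresses each power sum through coefficients and
    earlier power sums. Applied to two truncations of one series, this makes the sum over all roots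
    independent of the truncation. *)
Lemma root_prod_power_sum ws ws' n :
  (forall i, (i <= n)%N -> (root_prod ws)`_i = (root_prod ws')`_i) ->
  forall k, (k < n)%N -> \sum_(w <- ws) w ^- k.+1 = \sum_(w <- ws') w ^- k.+1.
Proof.
move=> E; have [q Eq] := root_prod_newton ws n.
have [q' Eq'] := root_prod_newton ws' n.
elim/ltn_ind => k IH kn.
have coefE us q0 : (root_prod us)^`() = 'X^n * q0 -
      root_prod us * \poly_(k < n) (\sum_(w <- us) w ^- k.+1) ->
    (root_prod us)`_k.+1 *+ k.+1 = - (\sum_(w <- us) w ^- k.+1 +
      \sum_(i < k) (root_prod us)`_i.+1 * \sum_(w <- us) w ^- (k - i)).
  move/(congr1 (fun p : {poly R[i]} => p`_k)).
  rewrite coef_deriv coefB coefXnM kn sub0r coefM => ->; congr (- _).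
  rewrite big_ord_recl root_prod0 mul1r coef_poly subn0 kn; congr (_ + _).
  apply: eq_bigr => i _; rewrite coef_poly /bump/=.
  rewrite ifT; last by have := ltn_ord i; lia.
  by congr (_ * _); rewrite subnSK.
have := coefE _ _ Eq; rewrite (E k.+1)// (coefE _ _ Eq') => /oppr_inj.
have -> : \sum_(i < k) (root_prod ws)`_i.+1 * \sum_(w <- ws) w ^- (k - i) =
    \sum_(i < k) (root_prod ws')`_i.+1 * \sum_(w <- ws') w ^- (k - i).
  apply: eq_bigr => i _; rewrite E; last by have := ltn_ord i; lia.
  congr (_ * _); have ik := ltn_ord i.
  by rewrite -subnSK// IH//; lia.
by move/addIr.
Qed.

End root_products.

(** * Blaschke factors and Jensen's inequality *)

Section blaschke.
Variable R : realType.
Implicit Types (ws : seq R[i]) (z w g : R[i]) (r M s e : R) (H p n : nat).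

(* On [|z| = r] this has the same modulus as [1 - z / w], but it has no zero
   in [|z| < r]. *)
Definition blaschke r w : {poly R[i]} :=
  if normc w < r then (r / normc w)%:C *: (1 - (w^* / (r ^+ 2)%:C) *: 'X)
  else 1 - w^-1 *: 'X.

Lemma normc_blaschke_small r w z : 0 < r -> normc w < r ->
  normc (blaschke r w).[z] =
    r / normc w * normc (1 - w^* / (r ^+ 2)%:C * z).
Proof.
move=> r0 wr; rewrite /blaschke wr !hornerE normcM normc_real_ge0//.
by rewrite divr_ge0 ?normc_ge0 ?ltW.
Qed.

Lemma blaschke_large r w z : r <= normc w -> (blaschke r w).[z] = 1 - z / w.
Proof. by move=> rw; rewrite /blaschke ltNge rw/= !hornerE mulrC. Qed.

(** The right-hand side vanishes on [|z| = r] and is nonnegative when [|z|] and [|w|] are at most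
    [r]. The first fact gives equality of moduli on the circle, the second the domination inside. *)
Lemma sqr_blaschke_sub r z w : 0 < r ->
  (normc (r%:C - w^* * z / r%:C)) ^+ 2 - normc (w - z) ^+ 2 =
  (r ^+ 2 - normc z ^+ 2) * (r ^+ 2 - normc w ^+ 2) / r ^+ 2.
Proof.
move=> r0.
have -> : r%:C - w^* * z / r%:C = r%:C - (r^-1)%:C * (w^* * z).
  by rewrite mulrC fmorphV.
rewrite !sqr_normcE; case: z => a b; case: w => c d /=.
by field; rewrite gt_eqF.
Qed.

Lemma blaschke_eq r w z : 0 < r -> w != 0 -> normc z = r ->
  normc (blaschke r w).[z] = normc (1 - z / w).
Proof.
move=> r0 w0 zr; have [wr|rw] := ltP (normc w) r; last by rewrite blaschke_large.
rewrite normc_blaschke_small//.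
have nw0 : 0 < normc w by rewrite normc_gt0.
apply: (mulIf (lt0r_neq0 nw0)); rewrite mulrAC divfK ?gt_eqF//.
rewrite -normcM mulrBl mul1r divfK//.
have rE : r = normc r%:C by rewrite normc_real_ge0 ?ltW.
rewrite {1}rE -normcM.
have -> : r%:C * (1 - w^* / (r ^+ 2)%:C * z) = r%:C - w^* * z / r%:C.
  by rewrite rmorphXn; field; rewrite fmorph_eq0 gt_eqF.
have := sqr_blaschke_sub z w r0; rewrite zr subrr mul0r mul0r => /eqP.
rewrite subr_eq0 => /eqP; move/(congr1 Num.sqrt).
by rewrite !sqrtr_sqr !ger0_norm ?normc_ge0.
Qed.

Lemma blaschke_ge r w z : 0 < r -> w != 0 -> normc z <= r ->
  normc (1 - z / w) <= normc (blaschke r w).[z].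
Proof.
move=> r0 w0 zr; have [wr|rw] := ltP (normc w) r; last by rewrite blaschke_large.
rewrite normc_blaschke_small//.
have nw0 : 0 < normc w by rewrite normc_gt0.
rewrite -(ler_pM2r nw0) mulrAC divfK ?gt_eqF//.
rewrite -normcM mulrBl mul1r divfK//.
have rE : r = normc r%:C by rewrite normc_real_ge0 ?ltW.
rewrite {1}rE -normcM.
have -> : r%:C * (1 - w^* / (r ^+ 2)%:C * z) = r%:C - w^* * z / r%:C.
  by rewrite rmorphXn; field; rewrite fmorph_eq0 gt_eqF.
rewrite -(ler_pXn2r (n:=2))// ?nnegrE ?normc_ge0//.
rewrite -subr_ge0 sqr_blaschke_sub// divr_ge0 ?sqr_ge0// mulr_ge0// subr_ge0.
  by rewrite lerXn2r// nnegrE ?normc_ge0// ltW.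
by rewrite lerXn2r ?nnegrE ?normc_ge0// ltW.
Qed.

Lemma blaschke0 r w : 0 < r -> (blaschke r w).[0] =
  (if normc w < r then r / normc w else 1)%:C.
Proof.
move=> r0; rewrite /blaschke; case: ifP => _; rewrite !hornerE ?subr0//.
by rewrite mulr1.
Qed.

Lemma blaschke_max ws g r M : 0 \notin ws -> 0 < r -> 0 < M ->
  (forall z, normc z = r -> normc g * \prod_(w <- ws) normc (1 - z / w) <= M) ->
  forall z, normc z <= r ->
    normc g * \prod_(w <- ws) normc (blaschke r w).[z] <= M.
Proof.
move=> ws0 r0 M0 gM z zr.
have E u : normc g * \prod_(w <- ws) normc (blaschke r w).[u] =
    normc (g *: \prod_(w <- ws) blaschke r w).[u].
  by rewrite hornerZ normcM horner_prod normc_prod.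
rewrite E; apply: (@poly_max_modulus _ _ r) => // u ur.
rewrite -E (le_trans _ (gM _ ur))// ler_wpM2l ?normc_ge0//.
rewrite le_eqVlt; apply/orP; left; apply/eqP; apply: eq_big_seq => w wws.
by rewrite blaschke_eq//; apply: contraNneq ws0 => <-.
Qed.

Lemma ln_prod (I : eqType) (t : seq I) (F : I -> R) :
  {in t, forall i, 0 < F i} -> ln (\prod_(i <- t) F i) = \sum_(i <- t) ln (F i).
Proof.
elim: t => [|i t IH] F0; first by rewrite !big_nil ln1.
have tF0 : {in t, forall i, 0 < F i}.
  by move=> j jt; apply: F0; rewrite inE jt orbT.
rewrite !big_cons lnM ?IH// posrE ?F0 ?mem_head//.
by rewrite big_seq; apply: prodr_gt0 => j /tF0.
Qed.

(** The bound on the product of Blaschke factors is read at the origin, where each replaced factor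
    equals [r / |w|] and every other factor equals 1. *)
Lemma jensen ws g r M : 0 \notin ws -> g != 0 -> 0 < r -> 0 < M ->
  (forall z, normc z = r -> normc g * \prod_(w <- ws) normc (1 - z / w) <= M) ->
  \sum_(w <- ws | normc w < r) ln (r / normc w) <= ln M - ln (normc g).
Proof.
move=> ws0 g0 r0 M0 gM.
have := blaschke_max ws0 r0 M0 gM (_ : normc 0 <= r).
rewrite normc0 => /(_ (ltW r0)).
have F0 : {in ws, forall w, 0 < if normc w < r then r / normc w else 1}.
  move=> w wws; case: ifP => // _; rewrite divr_gt0// normc_gt0.
  by apply: contraNneq ws0 => <-.
have -> : \prod_(w <- ws) normc (blaschke r w).[0] =
    \prod_(w <- ws) (if normc w < r then r / normc w else 1).
  apply: eq_big_seq => w wws; rewrite blaschke0// normc_real_ge0//.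
  exact/ltW/F0.
have P0 : 0 < \prod_(w <- ws) (if normc w < r then r / normc w else 1).
  by rewrite big_seq; apply: prodr_gt0 => w /F0.
have ng0 : 0 < normc g by rewrite normc_gt0.
move=> le1; rewrite lerBrDl.
have : ln (normc g * \prod_(w <- ws)
    (if normc w < r then r / normc w else 1)) <= ln M.
  by rewrite ler_ln ?posrE// mulr_gt0.
rewrite lnM ?posrE// ln_prod//; apply: le_trans; rewrite lerD2l.
rewrite big_mkcond/=; apply: ler_sum => w _.
by case: ifP => // _; rewrite ln1.
Qed.

(** In Jensen's sum for the radius [2 r], each root of modulus below [r] weighs at least [ln 2]. *)
Lemma root_count ws g r M : 0 \notin ws -> g != 0 -> 0 < r -> 0 < M ->
  (forall z, normc z = 2 * r ->
    normc g * \prod_(w <- ws) normc (1 - z / w) <= M) ->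
  (count (fun w => normc w < r) ws)%:R * ln 2 <= ln M - ln (normc g).
Proof.
move=> ws0 g0 r0 M0 gM.
apply: le_trans (jensen ws0 g0 (mulr_gt0 (ltr0Sn _ 1) r0) M0 gM).
have -> : (count (fun w => normc w < r) ws)%:R * ln 2 =
    \sum_(w <- ws | normc w < r) (ln 2 : R).
  by rewrite big_const_seq iter_addr addr0 mulr_natl.
rewrite big_mkcond [leRHS]big_mkcond/= big_seq [leRHS]big_seq.
apply: ler_sum => w wws.
have nw0 : 0 < normc w.
  by rewrite normc_gt0; apply: contraNneq ws0 => <-.
case: ifPn => [wr|_].
  rewrite ifT; last by rewrite (lt_trans wr)// ltr_pMl// ltr1n.
  rewrite ler_ln ?posrE ?divr_gt0 ?mulr_gt0// ler_pdivlMr// ler_pM2l//.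
  exact: ltW.
by case: ifP => // w2r; rewrite ln_ge0// ler_pdivlMr// mul1r ltW.
Qed.

End blaschke.

Section root_estimates.
Variable R : realType.
Implicit Types (ws : seq R[i]) (z w g : R[i]) (r M s e B : R) (H p n : nat).

Lemma ln_le_powR (s x : R) : 0 < s -> 0 < x -> ln x <= s^-1 * x `^ s.
Proof.
move=> s0 x0; rewrite -ler_pdivrMl ?invr_gt0// invrK -ln_powR.
by rewrite ltW// ln_sublinear// powR_gt0.
Qed.

Lemma powR_div_le (s : R) (x y : R) : 0 <= x -> 0 < y ->
  (x / y) `^ s = x `^ s * y `^ (- s).
Proof.
by move=> x0 y0; rewrite powRM ?invr_ge0 ?(ltW y0)// -powR_inv1 ?ltW// -powRrM mulN1r.
Qed.

(** The scalar [r / |w|] has logarithm at most [s^-1 (r / |w|)^s]. The remaining factor [1 - v] has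
    [|v| <= 1 - e], so its logarithm is at most [e^-1] in absolute value, which is absorbed because
    [r / |w|] is at least 1. *)
Lemma ln_blaschke_small r s e w z : 0 < r -> 0 < s -> 0 < e -> w != 0 ->
  normc z <= (1 - e) * r -> normc w < r ->
  `|ln (normc (blaschke r w).[z])| <=
    (s^-1 + e^-1) * (r `^ s * normc w `^ (- s)).
Proof.
move=> r0 s0 e0 w0 zr wr.
have nw0 : 0 < normc w by rewrite normc_gt0.
have rw1 : 1 <= r / normc w by rewrite ler_pdivlMr// mul1r ltW.
have rw0 : 0 < r / normc w by rewrite divr_gt0.
rewrite normc_blaschke_small//.
set v := w^* / (r ^+ 2)%:C * z.
have ve : normc v <= 1 - e.
  rewrite /v 2!normcM normc_conj normcV normc_real_ge0 ?sqr_ge0//.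
  rewrite mulrAC ler_pdivrMr ?exprn_gt0// mulrC expr2 mulrA.
  by apply: ler_pM; rewrite ?normc_ge0// ltW.
have v0 : 0 < normc (1 - v).
  by rewrite (lt_le_trans e0)// (le_trans _ (normc_1B_ge v))// lerBrDl addrC -lerBrDl.
rewrite lnM ?posrE// mulrDl (le_trans (ler_normD _ _))//.
rewrite -powR_div_le ?(ltW r0)//; apply: lerD.
  by rewrite ger0_norm ?ln_ge0// ln_le_powR.
have := ln_normc_taylor 0 e0 ve; rewrite big_ord0 addr0 => /le_trans; apply.
rewrite expr1 mulrC ler_wpM2l ?invr_ge0 ?(ltW e0)//.
apply: (@le_trans _ _ 1); last first.
  apply: (@le_trans _ _ (1 `^ s)); first by rewrite powR1.
  by rewrite ge0_ler_powR// ?nnegrE ?(ltW s0)// ltW.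
by rewrite (le_trans ve)// gerBl ltW.
Qed.

(** Inner roots go entirely into the error term. Outer roots satisfy [|z / w| <= 1 - e], so their
    logarithms are expanded to order [p], and the Taylor terms are regrouped into inverse power
    sums. *)
Lemma blaschke_estimate ws r s e z p : 0 \notin ws -> 0 < r -> 0 < s -> 0 < e ->
  normc z <= (1 - e) * r ->
  `|\sum_(w <- ws) ln (normc (blaschke r w).[z]) +
    \sum_(n < p) Re (z ^+ n.+1 *
       \sum_(w <- ws | r <= normc w) w ^- n.+1) / n.+1%:R| <=
  (s^-1 + e^-1) * (r `^ s * \sum_(w <- ws | normc w < r) normc w `^ (- s)) +
  e^-1 * \sum_(w <- ws | r <= normc w) (r / normc w) ^+ p.+1.
Proof.
move=> ws0 r0 s0 e0 zr.
pose T w := if r <= normc w then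
  \sum_(n < p) Re ((z / w) ^+ n.+1) / n.+1%:R else 0.
have -> : \sum_(n < p) Re (z ^+ n.+1 *
       \sum_(w <- ws | r <= normc w) w ^- n.+1) / n.+1%:R = \sum_(w <- ws) T w.
  rewrite -big_mkcond exchange_big/=; apply: eq_bigr => n _.
  rewrite mulr_sumr Re_sum mulr_suml; apply: eq_bigr => w _.
  by rewrite expr_div_n.
rewrite -big_split/= (le_trans (ler_norm_sum _ _ _))//.
rewrite mulrA !mulr_sumr [X in _ <= X + _]big_mkcond [X in _ <= _ + X]big_mkcond.
rewrite -big_split/= big_seq [leRHS]big_seq; apply: ler_sum => w wws.
have w0 : w != 0 by apply: contraNneq ws0 => <-.
rewrite /T; have [wr|rw] := ltP (normc w) r.
  by rewrite !addr0 -mulrA; exact: ln_blaschke_small.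
rewrite add0r blaschke_large//.
have nw0 : 0 < normc w by rewrite normc_gt0.
have vr : normc (z / w) <= (1 - e) * (r / normc w).
  by rewrite normcM normcV mulrA ler_pM2r ?invr_gt0.
have e1 : 0 <= 1 - e.
  by rewrite -(pmulr_lge0 _ r0) (le_trans (normc_ge0 z)).
have ve : normc (z / w) <= 1 - e.
  by rewrite (le_trans vr)// ler_piMr// ler_pdivrMr// mul1r.
apply: (le_trans (ln_normc_taylor p e0 ve)).
rewrite mulrC ler_wpM2l ?invr_ge0 ?(ltW e0)//.
rewrite lerXn2r ?nnegrE ?normc_ge0 ?divr_ge0 ?normc_ge0 ?(ltW r0)//.
rewrite (le_trans vr)// ler_piMl ?divr_ge0 ?normc_ge0 ?(ltW r0)//.
by rewrite gerBl ltW.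
Qed.

(** Dyadic decomposition with [d i = 2^i r]: at most [B (d i.+1)^H] roots lie below [d i.+1], each
    weighted by [(d i)^-(H+1)]. The extra power makes this a geometric series of ratio 1/2. *)
Lemma tail_sum_le ws r B H : 0 < r -> 0 <= B ->
  (forall rho, r <= rho -> (count (fun w => normc w < rho) ws)%:R <= B * rho ^+ H) ->
  \sum_(w <- ws | r <= normc w) normc w ^- H.+1 <= B * 2 ^+ H.+1 / r.
Proof.
move=> r0 B0 cB.
pose d i := 2 ^+ i * r.
have d0 i : 0 < d i by rewrite mulr_gt0// exprn_gt0.
have bern w : exists i, normc w < d i.
  exists (Num.truncn (normc w / r)).+1; rewrite /d -ltr_pdivrMr//.
  apply: (lt_le_trans (truncnS_gt _)).
  by rewrite -natrX ler_nat ltnW// ltn_expl.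
have [I IP] : exists I, {in ws, forall w, normc w < d I.+1}.
  elim: ws {cB} => [|w ws [I IP]]; first by exists 0%N.
  have [i iP] := bern w; exists (maxn i I); move=> u; rewrite inE.
  have dmon j k : (j <= k)%N -> d j <= d k.
    by move=> jk; rewrite ler_pM2r// ler_eXn2l ?ltr1n.
  case/orP => [/eqP->|/IP]; [move: iP|] => /lt_le_trans; apply; apply: dmon; lia.
(* [F w] overcounts, with one term for each disk that contains [w]; the term of the smallest such
   disk is already large enough, and the two sums can then be exchanged. *)
pose F w := \sum_(i < I.+1) (if normc w < d i.+1 then d i ^- H.+1 else 0).
have F0 w : 0 <= F w.
  by apply: sumr_ge0 => i _; case: ifP => // _; rewrite invr_ge0 exprn_ge0 ?ltW.
have wF : {in ws, forall w, r <= normc w -> normc w ^- H.+1 <= F w}.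
  move=> w wws rw.
  have [|i wi imin] := @ex_minnP (fun i => normc w < d i.+1).
    by exists I; exact: IP.
  have iI : (i < I.+1)%N by rewrite ltnS imin// IP.
  rewrite /F (bigD1 (Ordinal iI))//= wi.
  apply: (@le_trans _ _ (d i ^- H.+1)); last first.
    rewrite lerDl sumr_ge0// => j _; case: ifP => // _.
    by rewrite invr_ge0 exprn_ge0 ?ltW.
  have nw0 : 0 < normc w by rewrite (lt_le_trans r0).
  rewrite lef_pV2 ?posrE ?exprn_gt0// lerXn2r ?nnegrE ?normc_ge0 ?(ltW (d0 _))//.
  case: i wi imin {iI} => [|i] wi imin; first by rewrite /d mul1r.
  rewrite leNgt; apply/negP => /imin; lia.
apply: (@le_trans _ _ (\sum_(w <- ws) F w)).
  rewrite big_mkcond/= big_seq [leRHS]big_seq; apply: ler_sum => w wws.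
  by case: ifPn => // rw; exact: wF.
rewrite exchange_big/=.
have iE (i : 'I_I.+1) : \sum_(w <- ws) (if normc w < d i.+1 then d i ^- H.+1 else 0) <=
    B * 2 ^+ H / r * 2^-1 ^+ i.
  rewrite -big_mkcond big_const_seq iter_addr addr0 -[_ *+ _]mulr_natr.
  rewrite mulrC ler_pdivrMr ?exprn_gt0//.
  have rd : r <= d i.+1 by rewrite /d ler_peMl ?(ltW r0)// exprn_ege1// ler1n.
  rewrite (le_trans (cB _ rd))// le_eqVlt; apply/orP; left; apply/eqP.
  rewrite /d [2 ^+ i.+1]exprS exprMn exprMn exprVn [in RHS]exprS [in RHS]exprMn.
  by field; rewrite expf_neq0 ?pnatr_eq0// gt_eqF.
apply: (le_trans (ler_sum _ (fun i _ => iE i))).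
rewrite -mulr_sumr exprSr [B * (_ * _)]mulrA [X in _ <= X](mulrAC _ 2).
rewrite ler_wpM2l ?divr_ge0 ?mulr_ge0 ?exprn_ge0 ?(ltW r0)//.
have := subrX1 (2^-1 : R) I.+1; set S := \sum_(i < _) _.
have : 0 <= (2^-1 : R) ^+ I.+1 by rewrite exprn_ge0 ?invr_ge0.
lra.
Qed.

End root_estimates.

(** * Roots of the truncations of a power series *)

Section ultralimits.
Variables (R : realType) (U : set_system nat) (ultraU : UltraFilter U).

Definition ulim (x : nat -> R[i]) (l : R[i]) :=
  forall e : R, 0 < e -> U [set N | normc (x N - l) < e].

Lemma ultra_or (A B : set nat) : U (A `|` B) -> U A \/ U B.
Proof.
move=> UAB; have [|nA] := in_ultra_setVsetC A ultraU; first by left.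
right; apply: filterS2 UAB nA => N /= [].
  by move=> AN /(_ AN).
by [].
Qed.

Lemma ultra_notP (P : nat -> Prop) : ~ U [set N | P N] -> U [set N | ~ P N].
Proof. by have [|//] := in_ultra_setVsetC [set N | P N] ultraU. Qed.

Lemma ultra_nat_bounded (f : nat -> nat) B : U [set N | (f N <= B)%N] ->
  exists k, U [set N | f N = k].
Proof.
elim: B => [|B IH] UB.
  exists 0%N; apply: filterS UB => N /=; by rewrite leqn0 => /eqP.
have : U ([set N | (f N <= B)%N] `|` [set N | f N = B.+1]).
  apply: filterS UB => N /=; rewrite leq_eqVlt => /orP[/eqP|]; by [right|left].
by case/ultra_or => [/IH//|]; exists B.+1.
Qed.

Lemma real_ultralimit (x : nat -> R) B : U [set N | `|x N| <= B] ->
  exists l, forall e, 0 < e -> U [set N | `|x N - l| < e].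
Proof.
(* The limit is the supremum of the levels that [x N] reaches for [U]-almost all [N]; an ultrafilter
   decides every level. *)
move=> UB; pose A := [set y : R | U [set N | y <= x N]].
have hA : has_sup A.
  split; first by exists (- B); apply: filterS UB => N /=; rewrite ler_norml => /andP[].
  exists B => y Uy; have [N [/= yN]] := filter_ex (filterI Uy UB).
  by rewrite ler_norml => /andP[_]; exact: le_trans.
exists (sup A) => e e0.
have [y Ay ly] := sup_adherent e0 hA.
have nA : ~ A (sup A + e / 2).
  move=> Ale; have := ub_le_sup (proj2 hA) Ale.
  by rewrite gerDl leNgt divr_gt0.
move/ultra_notP: nA => nA; apply: filterS2 Ay nA => N /= yN /negP.
rewrite -ltNge => lN; rewrite ltr_distl; apply/andP; split; first exact: lt_le_trans yN.
by apply: (lt_trans lN); rewrite ltrD2l ltr_pdivrMr// ltr_pMr// ltr1n.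
Qed.

Lemma ulim_exists (x : nat -> R[i]) B : U [set N | normc (x N) <= B] ->
  exists l, ulim x l.
Proof.
move=> UB.
have [|a aP] := @real_ultralimit (fun N => Re (x N)) B.
  by apply: filterS UB => N; apply: le_trans; exact: Re_le_normc.
have [|b bP] := @real_ultralimit (fun N => Im (x N)) B.
  by apply: filterS UB => N; apply: le_trans; exact: Im_le_normc.
exists (a +i* b) => e e0.
have e2 : 0 < e / 2 by rewrite divr_gt0.
apply: filterS2 (aP _ e2) (bP _ e2) => N /= aN bN.
rewrite (le_lt_trans (normc_le_ReIm _))// [ltRHS](splitr e).
by case: (x N) aN bN => c d /= aN bN; rewrite ltrD.
Qed.

Lemma ulim_cst_le (x : nat -> R[i]) l y B : ulim x l ->
  U [set N | normc (x N - y) <= B] -> normc (l - y) <= B.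
Proof.
move=> xl UB; apply/ler_addgt0Pr => e e0.
have [N [/= lN BN]] := filter_ex (filterI (xl _ e0) UB).
have -> : l - y = (x N - y) - (x N - l) by ring.
by rewrite (le_trans (normcD _ _))// normcN lerD// ltW.
Qed.

Lemma ulim_ge (x : nat -> R[i]) l B : ulim x l ->
  U [set N | B <= normc (x N)] -> B <= normc l.
Proof.
move=> xl UB; apply/ler_addgt0Pr => e e0.
have [N [/= lN BN]] := filter_ex (filterI (xl _ e0) UB).
rewrite (le_trans BN)// -lerBlDl (le_trans (normc_sub_le _ _))// ltW//.
Qed.

Lemma ultra_forall_lt k (P : nat -> nat -> Prop) :
  (forall i, (i < k)%N -> U [set N | P i N]) ->
  U [set N | forall i, (i < k)%N -> P i N].
Proof.
elim: k => [|k IH] kP; first by apply: filterS filterT.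
have UP := IH (fun i ik => kP i (ltnW ik)).
apply: filterS2 UP (kP k (ltnSn k)) => N /= iP kN i.
by rewrite ltnS leq_eqVlt => /orP[/eqP->//|/iP].
Qed.

End ultralimits.

Section distinct_pairs.
Variable T : eqType.

(** Turns a list of limit points with repetitions into distinct pairs of a point and an index below
    its multiplicity, the format in which [bvalues] lists zeros. *)
Lemma multiset_pairs (v : seq T) : exists t : seq (T * nat),
  [/\ uniq t, [seq x.1 | x <- t] = v &
      forall x j, (x, j) \in t -> (j < count_mem x v)%N].
Proof.
elim: v => [|x v [t [ut tv tP]]]; first by exists [::].
exists ((x, count_mem x v) :: t); split => /=.
- by rewrite ut andbT; apply/negP => /tP; rewrite ltnn.
- by rewrite tv.
- move=> y j; rewrite inE => /orP[/eqP[-> ->]|/tP]; first by rewrite eqxx.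
  by move=> /leq_trans; apply; rewrite leq_addl.
Qed.

End distinct_pairs.

Section truncations.
Variables (R : realType) (gam : nat -> R[i]) (F : R -> R).
Hypothesis gam0 : gam 0%N != 0.
Hypothesis FP : forall N r, 0 <= r -> \sum_(n < N) normc (gam n) * r ^+ n <= F r.

Definition truncation N : {poly R[i]} := \poly_(n < N.+1) gam n.
Local Notation G := truncation.

Lemma majorant_ge r : 0 <= r -> normc (gam 0%N) <= F r.
Proof. by move=> r0; have := FP 1 r0; rewrite big_ord1 expr0 mulr1. Qed.

Lemma majorant_gt0 r : 0 <= r -> 0 < F r.
Proof. by move=> r0; rewrite (lt_le_trans _ (majorant_ge r0))// normc_gt0. Qed.

Lemma truncation_le N z r : normc z <= r -> normc (G N).[z] <= F r.
Proof.
move=> zr; have r0 := le_trans (normc_ge0 z) zr.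
rewrite horner_poly (le_trans (normc_sum _ _ _))// (le_trans _ (FP N.+1 r0))//.
apply: ler_sum => n _; rewrite normcM normcX ler_wpM2l ?normc_ge0//.
by rewrite lerXn2r ?nnegrE ?normc_ge0.
Qed.

Lemma coef_truncation N n : (n <= N)%N -> (G N)`_n = gam n.
Proof. by move=> nN; rewrite coef_poly ltnS nN. Qed.

Lemma truncation_roots : exists ws : nat -> seq R[i],
  forall N, 0 \notin ws N /\ G N = gam 0%N *: root_prod (ws N).
Proof.
suff /choice[us usP] : forall N, exists us, 0 \notin us /\ G N = gam 0%N *: root_prod us.
  by exists us.
move=> N; have := @root_prodP _ (G N).
by rewrite coef_truncation// => /(_ gam0)[us ? ?]; exists us.
Qed.

Variable ws : nat -> seq R[i].
Hypothesis wsP : forall N, 0 \notin ws N /\ G N = gam 0%N *: root_prod (ws N).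

Lemma truncation_neq0 N w : w \in ws N -> w != 0.
Proof. by move=> wN; apply: contraNneq (wsP N).1 => <-. Qed.

Lemma normc_truncation N z : normc (G N).[z] =
  normc (gam 0%N) * \prod_(w <- ws N) normc (1 - z / w).
Proof.
by rewrite (wsP N).2 hornerZ normcM horner_root_prod normc_prod.
Qed.

Lemma truncation_prod_le N r : 0 <= r -> forall z, normc z = r ->
  normc (gam 0%N) * \prod_(w <- ws N) normc (1 - z / w) <= F r.
Proof.
by move=> r0 z zr; rewrite -normc_truncation truncation_le ?zr.
Qed.

Lemma truncation_root N w : w \in ws N -> (G N).[w] = 0.
Proof.
move=> wN; rewrite (wsP N).2 hornerZ horner_root_prod (big_rem _ wN)/=.
by rewrite divff ?subrr ?mul0r ?mulr0// (truncation_neq0 wN).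
Qed.

Definition root_gap := normc (gam 0%N) / F 1.

Lemma root_gap_gt0 : 0 < root_gap.
Proof. by rewrite divr_gt0 ?normc_gt0// majorant_gt0. Qed.

(** At a root in the unit disk the constant term is cancelled by the others, whose sum is at most
    [|w| F(1)]. The bound is uniform in [N], so roots cannot drift to the origin. *)
Lemma root_gap_le N w : w \in ws N -> root_gap <= normc w.
Proof.
move=> wN; have F1 : 0 < F 1 by exact: majorant_gt0.
have [w1|w1] := leP 1 (normc w).
  by apply: le_trans w1; rewrite ler_pdivrMr// mul1r majorant_ge.
rewrite ler_pdivrMr//.
have := truncation_root wN; rewrite horner_poly big_ord_recl expr0 mulr1.
move/eqP; rewrite addr_eq0 => /eqP ->; rewrite normcN.
rewrite (le_trans (normc_sum _ _ _))//.
apply: (@le_trans _ _ (normc w * \sum_(n < N.+1) normc (gam n) * 1 ^+ n)).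
  rewrite big_ord_recl mulrDr; apply: ler_wpDl.
    by rewrite !mulr_ge0 ?normc_ge0 ?exprn_ge0.
  rewrite mulr_sumr; apply: ler_sum => i _.
  rewrite normcM normcX expr1n mulr1 mulrC ler_wpM2r ?normc_ge0//.
  by rewrite /bump/= exprS ler_piMr ?normc_ge0// exprn_ile1 ?normc_ge0// ltW.
by rewrite ler_wpM2l ?normc_ge0// FP.
Qed.

Lemma root_count_le N r : 0 < r ->
  (count (fun w => normc w < r) (ws N))%:R * ln 2 <=
    ln (F (2 * r)) - ln (normc (gam 0%N)).
Proof.
move=> r0; apply: root_count => //; first exact: (wsP N).1.
  by rewrite majorant_gt0// mulr_ge0// ltW.
by apply: truncation_prod_le; rewrite mulr_ge0// ltW.
Qed.

Lemma root_count_bounded r : 0 < r ->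
  exists B, forall N, (count (fun w => (normc w < r)%R) (ws N) <= B)%N.
Proof.
move=> r0; exists (Num.truncn ((ln (F (2 * r)) - ln (normc (gam 0%N))) / ln 2)) => N.
have l2 : 0 < ln (2 : R) by rewrite ln_gt0// ltr1n.
rewrite -(natrK (R:=R) (count _ _)); apply: le_truncn.
by rewrite ler_pdivlMr// root_count_le.
Qed.

(* On the circle of radius [r + 2] the removed factors are at least [1], so the
   maximum principle bounds the cofactor by [F (r + 2)]. *)
Lemma truncation_factor_le N z r : 0 < r -> normc z <= r + 2 ->
  normc (G N).[z] <=
    F (r + 2) * \prod_(w <- ws N | normc w < r) normc (z - w).
Proof.
move=> r0 zr.
pose h : {poly R[i]} := (gam 0%N * \prod_(w <- ws N | normc w < r) - w^-1) *:
  \prod_(w <- ws N | ~~ (normc w < r)) (1 - w^-1 *: 'X).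
have hE u : (G N).[u] = h.[u] * \prod_(w <- ws N | normc w < r) (u - w).
  rewrite (wsP N).2 hornerZ horner_root_prod (bigID (fun w => normc w < r))/=.
  rewrite /h hornerZ horner_prod.
  have -> : \prod_(w <- ws N | normc w < r) (1 - u / w) =
     (\prod_(w <- ws N | normc w < r) - w^-1) *
     \prod_(w <- ws N | normc w < r) (u - w).
    rewrite -big_split/= big_seq_cond [RHS]big_seq_cond.
    apply: eq_bigr => w /andP[/truncation_neq0 w0 _].
    by rewrite mulrBr !mulNr mulVf// opprK addrC mulrC.
  have -> : \prod_(w <- ws N | ~~ (normc w < r)) (1 - w^-1 *: 'X).[u] =
      \prod_(w <- ws N | ~~ (normc w < r)) (1 - u / w).
    by apply: eq_bigr => w _; rewrite !hornerE mulrC.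
  by rewrite -!mulrA [_ * \prod_(w <- _ | ~~ _) _]mulrC.
have r2 : 0 < r + 2 by rewrite addr_gt0.
rewrite hE normcM normc_prod ler_wpM2r ?prodr_ge0//.
  by move=> *; exact: normc_ge0.
apply: (@poly_max_modulus _ h (r + 2)) => // [|u ur].
  by rewrite majorant_gt0// ltW.
have P1 : 1 <= \prod_(w <- ws N | normc w < r) normc (u - w).
  have {1}-> : (1 : R) = \prod_(w <- ws N | normc w < r) 1 by rewrite big1.
  apply: ler_prod => w wr; rewrite ler01/= (le_trans _ (normc_sub_le _ _))//.
  by rewrite ur; lra.
have uF : normc (G N).[u] <= F (r + 2) by rewrite truncation_le ?ur.
apply: le_trans uF; rewrite hE normcM normc_prod ler_peMr ?normc_ge0//.
Qed.

End truncations.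

(** * Limits of the roots of the truncations *)

Section zeros_of_the_limit.
Variables (R : realType) (gam : nat -> R[i]) (F : R -> R).
Hypothesis gam0 : gam 0%N != 0.
Hypothesis FP : forall N r, 0 <= r -> \sum_(n < N) normc (gam n) * r ^+ n <= F r.
Local Notation G := (truncation gam).
Variable ws : nat -> seq R[i].
Hypothesis wsP : forall N, 0 \notin ws N /\ G N = gam 0%N *: root_prod (ws N).
Variables (U : set_system nat) (ultraU : UltraFilter U) (kap : nat).

Lemma powR_cont (a y e : R) : 0 < y -> 0 < e ->
  exists2 d : R, 0 < d & forall x, `|x - y| < d -> `|x `^ a - y `^ a| < e.
Proof.
move=> y0 e0.
have : {for y, continuous (fun x => x `^ a)}.
  apply: differentiable_continuous; apply/derivable1_diffP.
  by have [] := is_derive1_powR a y0.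
move=> /cvgrPdist_lt /(_ _ e0) /nbhs_ballP[d /= d0 dP].
exists d => // x xd; rewrite distrC; apply: dP.
by rewrite /ball/= distrC.
Qed.

(** Cauchy's estimate on a circle around [x]: the normalised derivatives at [x] are the coefficients
    of the recentred polynomial [q]. *)
Lemma normc_nderivn_le (p : {poly R[i]}) x j rho M : 0 < rho ->
  (forall h, normc h = rho -> normc p.[x + h] <= M) ->
  normc (p^`N(j)).[x] * rho ^+ j <= M.
Proof.
move=> rho0 pM.
pose q : {poly R[i]} := \poly_(i < size p) p^`N(i).[x].
have -> : (p^`N(j)).[x] = q`_j.
  by rewrite coef_poly; case: ltnP => // /nderivn_poly0 ->; rewrite horner0.
apply: poly_coef_bound => // h hr; rewrite horner_poly.
by rewrite -nderiv_taylor ?pM//; exact: mulrC.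
Qed.

Let A r N := [seq w <- ws N | normc w < r].

(** If [m] of the roots tend to [x], the polynomial is at most a constant times [rho ^+ m] on the
    circle of radius [rho] around [x]. Cauchy's estimate divides by [rho ^+ j] with [j < m], which
    leaves at least one factor [rho]. *)
Lemma ulim_nderivn_truncation r k (v : nat -> R[i]) x j : 0 < r ->
  U [set N | size (A r N) = k] ->
  (forall i, (i < k)%N -> ulim U (fun N => (A r N)`_i) (v i)) ->
  normc x <= r -> (j < count_mem x [seq v i | i <- iota 0 k])%N ->
  ulim U (fun N => (('X^kap * G N)^`N(j)).[x]) 0.
Proof.
move=> r0 UA vl xr; set m := count_mem _ _ => jm e e0.
(* [D] bounds the distance from [x + h] to any root in the disk. As it is at least 1, it may also
   multiply the small factors, which keeps the product bound uniform. *)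
pose D := 2 * r + 2.
have D1 : 1 <= D by rewrite /D; lra.
have D0 : 0 < D by lra.
pose C := (r + 2) ^+ kap * F (r + 2) * D ^+ k * 2 ^+ m.
have C0 : 0 < C.
  have F0 : 0 < F (r + 2) by rewrite (majorant_gt0 gam0 FP)// addr_ge0// ltW.
  rewrite /C mulr_gt0 ?exprn_gt0// mulr_gt0 ?exprn_gt0// mulr_gt0//.
  by rewrite exprn_gt0// addr_gt0.
pose rho := Num.min 1 (e / (2 * C)).
have rho0 : 0 < rho by rewrite lt_min ltr01 divr_gt0// mulr_gt0.
have rho1 : rho <= 1 by rewrite ge_min lexx.
have Crho : C * rho < e.
  apply: (@le_lt_trans _ _ (C * (e / (2 * C)))).
    by rewrite ler_pM2l// ge_min lexx orbT.
  rewrite invfM mulrCA [C * _]mulrC -mulrA mulVf ?gt_eqF// mulr1.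
  by rewrite ltr_pdivrMr// ltr_pMr// ltr1n.
have UN := ultra_forall_lt ultraU (fun i ik => vl i ik _ rho0).
apply: filterS2 UA UN => N /= sA vN; rewrite subr0.
apply: le_lt_trans Crho.
have Arho : forall h, normc h = rho ->
    normc ('X^kap * G N).[x + h] <=
      (r + 2) ^+ kap * (F (r + 2) * (D ^+ k * (2 * rho) ^+ m)).
  move=> h hr; have xh : normc (x + h) <= r + 2.
    by rewrite (le_trans (normcD _ _))// hr lerD// (le_trans rho1)// ler1n.
  rewrite hornerM hornerXn normcM normcX.
  apply: ler_pM; rewrite ?exprn_ge0 ?normc_ge0//.
    by rewrite lerXn2r// nnegrE ?normc_ge0// addr_ge0 ?ltW.
  rewrite (le_trans (truncation_factor_le gam0 FP wsP _ r0 xh))//.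
  rewrite ler_pM2l ?(majorant_gt0 gam0 FP) ?addr_ge0 ?(ltW r0)//.
  rewrite -big_filter -/(A r N) (big_nth 0) sA.
  have -> : D ^+ k * (2 * rho) ^+ m =
      \prod_(0 <= i < k) (D * (if v i == x then 2 * rho else 1)).
    rewrite big_split/= prodr_const_nat subn0; congr (_ * _).
    rewrite /m -big_mkcond -(big_map v (pred1 x) (fun=> 2 * rho)).
    by rewrite big_const_seq iter_mulr_1 /index_iota subn0.
  rewrite big_nat_cond [leRHS]big_nat_cond; apply: ler_prod => i /andP[/= ik _].
  rewrite normc_ge0/=.
  have wr : normc (A r N)`_i < r.
    have := mem_nth 0 (_ : (i < size (A r N))%N); rewrite sA => /(_ ik).
    by rewrite mem_filter => /andP[].
  case: eqP => [vx|_].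
    have -> : x + h - (A r N)`_i = h - ((A r N)`_i - v i) by rewrite vx; ring.
    rewrite (le_trans (normcD _ _))// normcN hr.
    have := vN _ ik; nra.
  rewrite (le_trans (normcD _ _))// normcN.
  have := normcD x h; rewrite hr /D; lra.
have := normc_nderivn_le j rho0 Arho.
rewrite exprMn => /le_trans => H; rewrite -(ler_pM2r (exprn_gt0 j rho0)).
apply: H; rewrite /C -!mulrA ler_pM2l ?exprn_gt0 ?addr_gt0//.
rewrite ler_pM2l ?(majorant_gt0 gam0 FP) ?addr_ge0 ?(ltW r0)//.
rewrite ler_pM2l ?exprn_gt0// ler_pM2l ?exprn_gt0//.
by rewrite -exprS; apply: ler_wiXn2l => //; exact: ltW.
Qed.

Variables (bv : set (R[i] * nat)) (s K : R).
Hypothesis s0 : 0 < s.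
Hypothesis bvP : forall x j, x != 0 ->
  (forall i, (i <= j)%N -> ulim U (fun N => (('X^kap * G N)^`N(i)).[x]) 0) -> bv (x, j).
Hypothesis bvK : forall t, uniq t -> (forall p, p \in t -> bv p) ->
  \sum_(p <- t) normc p.1 `^ (- s) <= K.

(* The roots of the truncations in a disk converge along the ultrafilter to
   zeros of the limit function, counted with multiplicity. *)
Lemma truncation_root_sum r : 0 < r ->
  U [set N | \sum_(w <- ws N | normc w < r) normc w `^ (- s) <= K + 1].
Proof.
move=> r0; apply: contrapT => /(ultra_notP ultraU) nU.
have [B BP] := root_count_bounded gam0 FP wsP r0.
(* The number of roots in the disk takes a single value [k] on a set of the ultrafilter, so the
   roots can be numbered and each followed to its own limit [v i]. *)
have [|k Uk] := @ultra_nat_bounded U ultraU (fun N => size (A r N)) B.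
  by apply: filterS filterT => N _ /=; rewrite size_filter.
have wA N i : size (A r N) = k -> (i < k)%N -> (A r N)`_i \in A r N.
  by move=> <-; exact: mem_nth.
have : forall i, exists l, (i < k)%N -> ulim U (fun N => (A r N)`_i) l.
  move=> i; have [ik|_] := ltnP i k; last by exists 0.
  have [|l lP] := @ulim_exists R U ultraU (fun N => (A r N)`_i) r; last by exists l.
  apply: filterS Uk => N /= /wA /(_ ik); rewrite mem_filter => /andP[/ltW//].
case/choice => v vP.
have vr i : (i < k)%N -> normc (v i) <= r.
  move=> ik; rewrite -(subr0 (v i)); apply: (ulim_cst_le ultraU (vP _ ik)).
  apply: filterS Uk => N /= /wA /(_ ik); rewrite mem_filter subr0 => /andP[/ltW//].
have v0 i : (i < k)%N -> 0 < normc (v i).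
  move=> ik; apply: (lt_le_trans (root_gap_gt0 gam0 FP)).
  apply: (ulim_ge ultraU (vP _ ik)).
  apply: filterS Uk => N /= /wA /(_ ik); rewrite mem_filter => /andP[_].
  exact: (root_gap_le gam0 FP wsP).
have [t [ut tv tP]] := multiset_pairs [seq v i | i <- iota 0 k].
have tbv p : p \in t -> bv p.
  case: p => x j xjt.
  have : x \in [seq v i | i <- iota 0 k] by rewrite -tv; apply/mapP; exists (x, j).
  case/mapP => i; rewrite mem_iota add0n => /andP[_ ik] xv.
  apply: bvP => [|l lj]; first by rewrite xv -normc_gt0 v0.
  apply: (ulim_nderivn_truncation r0 Uk vP); first by rewrite xv vr.
  by rewrite (leq_ltn_trans lj)// tP.
have tK := bvK ut tbv.
have tE : \sum_(p <- t) normc p.1 `^ (- s) = \sum_(0 <= i < k) normc (v i) `^ (- s).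
  rewrite -(big_map fst xpredT (fun x => normc x `^ (- s))) tv big_map.
  by rewrite /index_iota subn0.
(* Each of the [k] terms may be off by [1 / (k + 1)]; together they stay within the slack 1 of the
   bound [K + 1]. *)
have e0 : 0 < (k.+1%:R : R)^-1 by rewrite invr_gt0.
have near i : (i < k)%N -> U [set N |
    `|normc (A r N)`_i `^ (- s) - normc (v i) `^ (- s)| < k.+1%:R^-1].
  move=> ik; have [d d0 dP] := powR_cont (- s) (v0 _ ik) e0.
  apply: filterS (vP _ ik _ d0) => N /= dN; apply: dP.
  exact: le_lt_trans (normc_dist _ _) dN.
have Unear := ultra_forall_lt ultraU near.
have [N [/= [sN nN] nearN]] := filter_ex (filterI (filterI Uk nU) Unear).
apply: nN; rewrite -big_filter -/(A r N) (big_nth 0) sN.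
apply: (@le_trans _ _ (\sum_(0 <= i < k) (normc (v i) `^ (- s) + k.+1%:R^-1))).
  rewrite big_nat_cond [leRHS]big_nat_cond; apply: ler_sum => i /andP[/= ik _].
  by have := nearN _ ik; rewrite ltr_distl => /andP[_ /ltW].
rewrite big_split/= -tE lerD// sumr_const_nat subn0 -[_ *+ _]mulr_natr mulrC.
by rewrite ler_pdivrMr// mul1r ler_nat.
Qed.

End zeros_of_the_limit.

(** * The exponential polynomial *)

Section subsums.
Variable R : realType.

Lemma ler_subsum (I : eqType) (t : seq I) (P Q : pred I) (f g : I -> R) :
  {in t, forall i, P i -> Q i /\ f i <= g i} -> (forall i, 0 <= g i) ->
  \sum_(i <- t | P i) f i <= \sum_(i <- t | Q i) g i.
Proof.
move=> fg g0; rewrite big_mkcond [leRHS]big_mkcond/= big_seq [leRHS]big_seq.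
apply: ler_sum => i it; case: ifP => [/(fg _ it)[-> //]|_].
by case: ifP.
Qed.

End subsums.

Section exponential_polynomial.
Variables (R : realType) (gam : nat -> R[i]) (F : R -> R).
Hypothesis gam0 : gam 0%N != 0.
Hypothesis FP : forall N r, 0 <= r -> \sum_(n < N) normc (gam n) * r ^+ n <= F r.
Local Notation G := (truncation gam).
Variable ws : nat -> seq R[i].
Hypothesis wsP : forall N, 0 \notin ws N /\ G N = gam 0%N *: root_prod (ws N).
Variables (U : set_system nat) (ultraU : UltraFilter U).
Hypothesis U_infty : forall n, U [set N | (n <= N)%N].
Variables (s K : R) (H : nat) (r0 : R).
Hypothesis s0 : 0 < s.
Hypothesis sH : s <= H.+1%:R.
Hypothesis r01 : 1 <= r0.
Hypothesis FH : forall r, r0 <= r -> ln (F r) <= r ^+ H.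
Hypothesis wK : forall r, 0 < r ->
  U [set N | \sum_(w <- ws N | normc w < r) normc w `^ (- s) <= K].

Definition inverse_power_sum N n r :=
  \sum_(w <- ws N | r <= normc w) w ^- n.+1.
Local Notation T := inverse_power_sum.

Lemma full_power_sum n : exists P,
  U [set N | \sum_(w <- ws N) w ^- n.+1 = P].
Proof.
exists (\sum_(w <- ws n.+1) w ^- n.+1).
apply: filterS (U_infty n.+1) => N /= nN.
apply: (@root_prod_power_sum _ _ _ n.+1) => // i iN.
apply: (mulfI gam0); rewrite -!coefZ -!(wsP _).2.
by rewrite !coef_truncation// (leq_trans iN).
Qed.

Lemma inverse_power_sumE N n r : T N n r =
  \sum_(w <- ws N) w ^- n.+1 - \sum_(w <- ws N | normc w < r) w ^- n.+1.
Proof.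
rewrite [in RHS](bigID (fun w => normc w < r))/= addrAC subrr add0r.
by apply: eq_bigl => w; rewrite -leNgt.
Qed.

Lemma inverse_power_sum_bounded n r : 0 < r ->
  exists B, U [set N | normc (T N n r) <= B].
Proof.
move=> rgt0; have [P PP] := full_power_sum n.
have [B BP] := root_count_bounded gam0 FP wsP rgt0.
have gap0 := root_gap_gt0 gam0 FP.
exists (normc P + B%:R * (root_gap gam F) ^- n.+1).
apply: filterS PP => N /= PN; rewrite inverse_power_sumE PN.
rewrite (le_trans (normcD _ _))// normcN lerD2l (le_trans (normc_sum _ _ _))//.
apply: (@le_trans _ _ (\sum_(w <- ws N | normc w < r) (root_gap gam F) ^- n.+1)).
  rewrite big_seq_cond [leRHS]big_seq_cond; apply: ler_sum => w /andP[wN _].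
  rewrite normcV normcX lef_pV2 ?posrE ?exprn_gt0 ?normc_gt0//; last first.
    exact: (truncation_neq0 wsP wN).
  rewrite lerXn2r ?nnegrE ?normc_ge0 ?(ltW gap0)//.
  exact: (root_gap_le gam0 FP wsP wN).
rewrite big_const_seq iter_addr addr0 -[_ *+ _]mulr_natr mulrC.
by rewrite ler_wpM2r ?invr_ge0 ?exprn_ge0 ?(ltW gap0)// ler_nat.
Qed.

Lemma expr_le_powR_lt1 (q : R) n : 0 < q <= 1 -> s <= n%:R -> q ^+ n <= q `^ s.
Proof.
move=> /andP[q0 q1] sn; rewrite -powR_mulrn ?(ltW q0)//.
by apply: ger_powR; rewrite ?q0.
Qed.

Lemma expr_le_powR_gt1 (q : R) n : 1 <= q -> n%:R <= s -> q ^+ n <= q `^ s.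
Proof.
move=> q1 sn; rewrite -powR_mulrn ?(le_trans ler01)//.
by apply: ler_powR.
Qed.

(** In the annulus [r / |w| <= 1], so the power [n.+1] of this ratio is at most its power [s]. The
    bound does not depend on [r'], which lets the outer radius grow. *)
Lemma annulus_power_sum n r r' : 0 < r -> r <= r' -> s <= n.+1%:R ->
  U [set N | r ^+ n.+1 * normc (T N n r - T N n r') <= K * r `^ s].
Proof.
move=> rgt0 rr' sn; have r'0 := lt_le_trans rgt0 rr'.
apply: filterS (wK r'0) => N /= NK.
have -> : T N n r - T N n r' =
    \sum_(w <- ws N | (normc w < r') && (r <= normc w)) w ^- n.+1.
  rewrite /T (bigID (fun w => normc w < r'))/= -[RHS]addr0 -addrA; congr (_ + _).
    by apply: eq_bigl => w; rewrite andbC.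
  apply/eqP; rewrite subr_eq0; apply/eqP/eq_bigl => w; rewrite -leNgt.
  by apply: andb_idl; exact: le_trans.
rewrite mulrC (le_trans (ler_wpM2r _ (normc_sum _ _ _))) ?exprn_ge0 ?(ltW rgt0)//.
rewrite (le_trans _ (ler_wpM2r (powR_ge0 _ _) NK))// !mulr_suml.
apply: ler_subsum => [w wN /andP[wr' rw]|w]; last by rewrite mulr_ge0 ?powR_ge0.
split=> //; have nw0 : 0 < normc w by rewrite normc_gt0 (truncation_neq0 wsP wN).
rewrite normcV normcX mulrC -expr_div_n [leRHS]mulrC -powR_div_le ?(ltW rgt0)//.
by apply: expr_le_powR_lt1 => //; rewrite divr_gt0//= ler_pdivrMr// mul1r.
Qed.

(** The outer sum is the sum over all roots, eventually a constant [P], minus the inner sum. Both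
    are of the admissible size: [r ^+ n.+1 <= r^s], and [(r / |w|)^(n+1) <= (r / |w|)^s] for inner
    roots. This is why the coefficient [D n] can be taken to be 0. *)
Lemma low_power_sum n : n.+1%:R <= s -> exists C, forall r, 1 <= r ->
  U [set N | r ^+ n.+1 * normc (T N n r) <= C * r `^ s].
Proof.
move=> ns; have [P PP] := full_power_sum n.
exists (normc P + K) => r r1; have rgt0 := lt_le_trans ltr01 r1.
apply: filterS2 PP (wK rgt0) => N /= PN NK; rewrite inverse_power_sumE PN.
rewrite mulrC (le_trans (ler_wpM2r _ (normcD _ _))) ?exprn_ge0 ?(ltW rgt0)//.
rewrite normcN !mulrDl; apply: lerD.
  by rewrite ler_wpM2l ?normc_ge0// expr_le_powR_gt1.
rewrite (le_trans (ler_wpM2r _ (normc_sum _ _ _))) ?exprn_ge0 ?(ltW rgt0)//.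
rewrite (le_trans _ (ler_wpM2r (powR_ge0 _ _) NK))// !mulr_suml.
apply: ler_subsum => [w wN wr|w]; last by rewrite mulr_ge0 ?powR_ge0.
split=> //; have nw0 : 0 < normc w by rewrite normc_gt0 (truncation_neq0 wsP wN).
rewrite normcV normcX mulrC -expr_div_n [leRHS]mulrC -powR_div_le ?(ltW rgt0)//.
by apply: expr_le_powR_gt1 => //; rewrite ler_pdivlMr// mul1r ltW.
Qed.

(** Two successive limits: [tau k] is the limit in [N] of the sum outside radius [k.+1], and [D] is
    the limit of [tau]. The annulus bound compares every radius [r] with a larger [k.+1], so one [D]
    serves all [r]. *)
Lemma high_power_sum n : s <= n.+1%:R -> exists D, exists C, forall r, 1 <= r ->
  U [set N | r ^+ n.+1 * normc (T N n r - D) <= C * r `^ s].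
Proof.
move=> sn.
have : forall k : nat, exists l, ulim U (fun N => T N n k.+1%:R) l.
  move=> k; have [|B BP] := @inverse_power_sum_bounded n k.+1%:R; first by [].
  by have [l lP] := ulim_exists ultraU BP; exists l.
case/choice => tau tauP.
have tauB r k : 1 <= r -> r <= k.+1%:R -> forall e, 0 < e ->
    U [set N | r ^+ n.+1 * normc (T N n r - tau k) <= K * r `^ s + r ^+ n.+1 * e].
  move=> r1 rk e e0; have rgt0 := lt_le_trans ltr01 r1.
  apply: filterS2 (annulus_power_sum rgt0 rk sn) (tauP k _ e0) => N /= AN tN.
  have -> : T N n r - tau k =
      (T N n r - T N n k.+1%:R) + (T N n k.+1%:R - tau k) by ring.
  rewrite (le_trans (ler_wpM2l _ (normcD _ _))) ?exprn_ge0 ?(ltW rgt0)//.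
  by rewrite mulrDr lerD// ler_wpM2l ?exprn_ge0 ?(ltW rgt0)// ltW.
(* At radius 1 both [tau k] and [tau 0] are compared with the same sum [T N n 1]: the gaps are at
   most [K + 1] and 1. *)
have [|D DP] := @ulim_exists R U ultraU tau (normc (tau 0%N) + K + 2).
  apply: filterS filterT => k _ /=.
  have k1 : 1 <= k.+1%:R :> R by rewrite ler1n.
  have [N [/= a b]] := filter_ex (filterI (tauB 1 k (lexx _) k1 1 ltr01)
    (tauP 0%N _ ltr01)).
  have {}a : normc (T N n 1 - tau k) <= K + 1.
    by move: a; rewrite !expr1n !mul1r powR1 mulr1.
  have {}b : normc (T N n 1 - tau 0%N) < 1 by exact: b.
  have -> : tau k = tau 0%N + (T N n 1 - tau 0%N) - (T N n 1 - tau k) by ring.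
  rewrite (le_trans (normcD _ _))// normcN.
  apply: (le_trans (lerD (le_trans (normcD _ _) (lerD (lexx _) (ltW b))) a)).
  lra.
exists D; exists (K + 2) => r r1; have rgt0 := lt_le_trans ltr01 r1.
(* After scaling by [r ^+ n.+1], this tolerance costs exactly one [r^s]. It is spent once in each
   limit, hence [K + 2]. *)
have e0 : 0 < r `^ s / r ^+ n.+1 by rewrite divr_gt0 ?powR_gt0 ?exprn_gt0.
have [k [/= Dk rk]] := filter_ex (filterI (DP _ e0) (U_infty (Num.truncn r).+1)).
have {}rk : r <= k.+1%:R.
  by rewrite (le_trans (ltW (truncnS_gt r)))// ler_nat leqW.
apply: filterS (tauB _ _ r1 rk _ e0) => N /=.
have -> : r ^+ n.+1 * (r `^ s / r ^+ n.+1) = r `^ s.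
  by rewrite mulrCA divff ?mulr1// expf_neq0// gt_eqF.
move=> tN.
have -> : T N n r - D = (T N n r - tau k) + (tau k - D) by ring.
rewrite (le_trans (ler_wpM2l _ (normcD _ _))) ?exprn_ge0 ?(ltW rgt0)//.
move: Dk; rewrite ltr_pdivlMr ?exprn_gt0// mulrC => Dk.
by rewrite mulrDr; lra.
Qed.

Lemma power_sum_limit : exists D : nat -> R[i],
  (forall n, n.+1%:R <= s -> D n = 0) /\
  forall n, exists C, forall r, 1 <= r ->
    U [set N | r ^+ n.+1 * normc (T N n r - D n) <= C * r `^ s].
Proof.
have : forall n, exists d, (n.+1%:R <= s -> d = 0) /\
    exists C, forall r, 1 <= r ->
    U [set N | r ^+ n.+1 * normc (T N n r - d) <= C * r `^ s].
  move=> n; have [ns|sn] := leP n.+1%:R s.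
    exists 0; split=> //; have [C CP] := low_power_sum ns; exists C => r /CP.
    by apply: filterS => N /=; rewrite subr0.
  by have [d dP] := high_power_sum (ltW sn); exists d.
by case/choice => D DP; exists D; split=> n; have [] := DP n.
Qed.

(** [wK] treats one radius at a time, so it covers the roots only up to a chosen [r']. Beyond it the
    counting bound from Jensen's inequality, valid for every [N], takes over. *)
Lemma far_roots : exists C, forall r, r0 <= r ->
  U [set N | \sum_(w <- ws N | r <= normc w) (r / normc w) ^+ H.+1 <= C * r `^ s].
Proof.
pose B := (2 ^+ H + `|ln (normc (gam 0%N))|) / ln 2.
have l2 : 0 < ln (2 : R) by rewrite ln_gt0// ltr1n.
have B0 : 0 <= B by rewrite divr_ge0 ?ltW// addr_ge0 ?exprn_ge0.
exists (K + 1) => r rr0.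
have r1 := le_trans r01 rr0; have rgt0 := lt_le_trans ltr01 r1.
(* The dyadic tail beyond [r'] is at most [B * 2 ^+ H.+1 / r']; this [r'] makes it at most 1 after
   multiplication by [r ^+ H.+1], and [1 <= r^s]. *)
pose r' := r + r ^+ H.+1 * (B * 2 ^+ H.+1).
have X0 : 0 <= r ^+ H.+1 * (B * 2 ^+ H.+1).
  by rewrite mulr_ge0 ?exprn_ge0 ?(ltW rgt0)// mulr_ge0// exprn_ge0.
have rr' : r <= r' by rewrite lerDl.
have r'0 := lt_le_trans rgt0 rr'.
apply: filterS (wK r'0) => N /= NK.
rewrite (bigID (fun w => normc w < r'))/= mulrDl; apply: lerD.
  rewrite (le_trans _ (ler_wpM2r (powR_ge0 _ _) NK))// !mulr_suml.
  apply: ler_subsum => [w wN /andP[rw wr']|w]; last by rewrite mulr_ge0 ?powR_ge0.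
  split=> //; have nw0 : 0 < normc w by rewrite normc_gt0 (truncation_neq0 wsP wN).
  rewrite [leRHS]mulrC -powR_div_le ?(ltW rgt0)//.
  by apply: expr_le_powR_lt1 => //; rewrite divr_gt0//= ler_pdivrMr// mul1r.
apply: (@le_trans _ _ 1); last first.
  rewrite mul1r; apply: (@le_trans _ _ (1 `^ s)); first by rewrite powR1.
  by rewrite ge0_ler_powR// ?nnegrE ?(ltW s0)// ltW.
have cB rho : r' <= rho ->
    (count (fun w => normc w < rho) (ws N))%:R <= B * rho ^+ H.
  move=> r'rho; have rho1 : r0 <= rho by rewrite (le_trans rr0)// (le_trans rr').
  have rho0 := lt_le_trans ltr01 (le_trans r01 rho1).
  rewrite /B mulrAC ler_pdivlMr//.
  rewrite (le_trans (root_count_le gam0 FP wsP _ rho0))// [leRHS]mulrDl -exprMn.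
  apply: lerD; first by apply: FH; rewrite (le_trans rho1)// ler_peMl ?(ltW rho0)// ler1n.
  rewrite (le_trans (ler_norm _))// normrN ler_peMr//.
  by rewrite exprn_ege1// (le_trans r01).
have := tail_sum_le r'0 B0 cB.
move=> /(ler_wpM2l (exprn_ge0 H.+1 (ltW rgt0))) => tail.
apply: (@le_trans _ _ (r ^+ H.+1 * (B * 2 ^+ H.+1 / r'))).
  apply: le_trans tail; rewrite mulr_sumr.
  apply: ler_subsum => [w wN /andP[rw wr']|w]; last first.
    by rewrite mulr_ge0 ?invr_ge0 ?exprn_ge0 ?normc_ge0// ltW.
  by rewrite leNgt wr' expr_div_n.
by rewrite mulrA ler_pdivrMr// mul1r /r' lerDr ltW.
Qed.

End exponential_polynomial.

(** * Comparison of the function with the exponential polynomial *)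

Section main_estimate.
Variables (R : realType) (gam : nat -> R[i]) (F : R -> R).
Hypothesis gam0 : gam 0%N != 0.
Hypothesis FP : forall N r, 0 <= r -> \sum_(n < N) normc (gam n) * r ^+ n <= F r.
Local Notation G := (truncation gam).
Variable ws : nat -> seq R[i].
Hypothesis wsP : forall N, 0 \notin ws N /\ G N = gam 0%N *: root_prod (ws N).
Variables (U : set_system nat) (ultraU : UltraFilter U).
Hypothesis U_infty : forall n, U [set N | (n <= N)%N].
Variables (s K : R) (H : nat) (r0 : R).
Hypothesis s0 : 0 < s.
Hypothesis sH : s <= H.+1%:R.
Hypothesis r01 : 1 <= r0.
Hypothesis FH : forall r, r0 <= r -> ln (F r) <= r ^+ H.
Hypothesis wK : forall r, 0 < r ->
  U [set N | \sum_(w <- ws N | normc w < r) normc w `^ (- s) <= K].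
Variable g : R[i] -> R[i].
Hypothesis gP : forall z, ulim U (fun N => (G N).[z]) (g z).

(* [D n] is the limit of the sums of [w ^- n.+1] over the roots of the truncations
   lying outside the disk of radius [r]. *)
Definition log_poly (D : nat -> R[i]) (z : R[i]) : R :=
  - \sum_(n < H) Re (z ^+ n.+1 * D n) / n.+1%:R.

Lemma blaschke_gt0 (r : R) w z : 0 < r -> w != 0 -> normc z < r ->
  0 < normc (blaschke r w).[z].
Proof.
move=> rgt0 w0 zr; have nw0 : 0 < normc w by rewrite normc_gt0.
have [wr|rw] := ltP (normc w) r; last first.
  rewrite blaschke_large// (lt_le_trans _ (normc_1B_ge _))//.
  by rewrite subr_gt0 normcM normcV ltr_pdivrMr// mul1r (lt_le_trans zr).
rewrite normc_blaschke_small// mulr_gt0 ?divr_gt0//.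
rewrite (lt_le_trans _ (normc_1B_ge _))// subr_gt0 2!normcM normc_conj normcV.
rewrite normc_real_ge0 ?sqr_ge0// mulrAC ltr_pdivrMr ?exprn_gt0// mul1r expr2.
by rewrite ltr_pM ?normc_ge0.
Qed.

Lemma sum_ln_blaschke_estimate : exists D : nat -> R[i],
  (forall n, n.+1%:R <= s -> D n = 0) /\
  forall e, 0 < e -> exists C, forall r, r0 <= r ->
    U [set N | forall z, normc z <= (1 - e) * r ->
      `|\sum_(w <- ws N) ln (normc (blaschke r w).[z]) - log_poly D z| <= C * r `^ s].
Proof.
have [D [Ds DP]] := power_sum_limit gam0 FP wsP ultraU U_infty wK.
exists D; split=> // e e0.
have [Cn CnP] := choice DP.
have [Cf CfP] := far_roots gam0 FP wsP ultraU s0 sH r01 FH wK.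
exists ((s^-1 + e^-1) * K + e^-1 * Cf + \sum_(n < H) Cn n) => r rr0.
have r1 := le_trans r01 rr0; have rgt0 := lt_le_trans ltr01 r1.
(* Only [H] power sums occur and none depends on [z], so one set of indices in the ultrafilter
   serves every [z]. *)
have UD := ultra_forall_lt ultraU (fun n (_ : (n < H)%N) => CnP n r r1).
apply: filterS2 (filterI (wK rgt0) (CfP r rr0)) UD => N /= [NK Nf] ND z zr.
set S := \sum_(w <- ws N) _.
have est := blaschke_estimate H (wsP N).1 rgt0 s0 e0 zr; rewrite -/S in est.
pose V := \sum_(n < H) Re (z ^+ n.+1 *
       \sum_(w <- ws N | r <= normc w) w ^- n.+1) / n.+1%:R.
have -> : S - log_poly D z = (S + V) + (- log_poly D z - V) by ring.
rewrite (le_trans (ler_normD _ _))// [leRHS]mulrDl; apply: lerD.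
  rewrite (le_trans est)// [leRHS]mulrDl; apply: lerD.
    rewrite -mulrA ler_wpM2l ?addr_ge0 ?invr_ge0 ?(ltW s0) ?(ltW e0)//.
    by rewrite mulrC ler_wpM2r ?powR_ge0.
  by rewrite -mulrA ler_wpM2l ?invr_ge0 ?(ltW e0).
have ez : normc z <= r by rewrite (le_trans zr)// ler_piMl ?(ltW rgt0)// gerBl ltW.
rewrite /log_poly opprK /V -sumrB (le_trans (ler_norm_sum _ _ _))// mulr_suml.
apply: ler_sum => n _; rewrite -mulrBl -ReN -ReD -mulrBr.
rewrite normrM normfV normr_nat ler_pdivrMr ?ltr0n//.
rewrite (le_trans (Re_le_normc _))//.
apply: (@le_trans _ _ (Cn n * r `^ s)).
  apply: le_trans (ND n _) => //; rewrite normcM normcX normcB.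
  by rewrite ler_wpM2r ?normc_ge0// lerXn2r ?nnegrE ?normc_ge0 ?(ltW rgt0).
have Cn0 : 0 <= Cn n * r `^ s.
  apply: le_trans (ND n _) => //.
  by rewrite mulr_ge0 ?normc_ge0 ?exprn_ge0 ?(ltW rgt0).
by rewrite ler_peMr// ler1n.
Qed.

Lemma exponential_estimate : exists D : nat -> R[i],
  (forall n, n.+1%:R <= s -> D n = 0) /\
  forall e, 0 < e -> exists C, forall r, r0 <= r ->
    forall z, normc z <= (1 - e) * r ->
      log_poly D z <= ln (F r) + C * r `^ s /\
      normc (g z) <= expR (log_poly D z + C * r `^ s).
Proof.
have [D [Ds DP]] := sum_ln_blaschke_estimate; exists D; split=> // e e0.
have [C CP] := DP _ e0; exists (C + `|ln (normc (gam 0%N))|) => r rr0 z zr.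
have r1 := le_trans r01 rr0; have rgt0 := lt_le_trans ltr01 r1.
have g0 : 0 < normc (gam 0%N) by rewrite normc_gt0.
have rs1 : 1 <= r `^ s.
  apply: (@le_trans _ _ (1 `^ s)); first by rewrite powR1.
  by rewrite ge0_ler_powR// ?nnegrE ?(ltW s0)// ltW.
have lg : `|ln (normc (gam 0%N))| <= `|ln (normc (gam 0%N))| * r `^ s.
  by rewrite ler_peMr.
have zr' : normc z < r.
  by rewrite (le_lt_trans zr)// gtr_pMl// gtrBl.
have bl0 N : {in ws N, forall w, 0 < normc (blaschke r w).[z]}.
  by move=> w wN; apply: blaschke_gt0 => //; exact: (truncation_neq0 wsP wN).
have Pbl0 N : 0 < \prod_(w <- ws N) normc (blaschke r w).[z].
  by rewrite big_seq; apply: prodr_gt0 => w /bl0.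
split.
  (* The inequality to prove does not mention [N], so a single good index suffices; the upper bound
     below has to pass to the limit. *)
  have [N /= /(_ z zr)] := filter_ex (CP r rr0).
  rewrite ler_distl => /andP[lo _].
  have le1 := blaschke_max (wsP N).1 rgt0 (majorant_gt0 gam0 FP (ltW rgt0))
    (truncation_prod_le FP wsP N (ltW rgt0)) (ltW zr').
  have F0 : 0 < F r by rewrite (majorant_gt0 gam0 FP)// ltW.
  have : ln (normc (gam 0%N) * \prod_(w <- ws N) normc (blaschke r w).[z]) <= ln (F r).
    by rewrite ler_ln ?posrE// mulr_gt0.
  rewrite lnM ?posrE// ln_prod// => hi.
  have := ler_norm (- ln (normc (gam 0%N))); rewrite normrN mulrDl.
  move: lo hi lg; lra.
rewrite -(subr0 (g z)); apply: (ulim_cst_le ultraU (gP z)).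
apply: filterS (CP r rr0) => N /= /(_ z zr).
rewrite ler_distl subr0 => /andP[_ hi].
rewrite (normc_truncation wsP).
apply: (@le_trans _ _ (normc (gam 0%N) * \prod_(w <- ws N) normc (blaschke r w).[z])).
  rewrite ler_pM2l// big_seq [leRHS]big_seq; apply: ler_prod => w wN.
  rewrite normc_ge0/=; apply: blaschke_ge => //; last exact: ltW.
  exact: (truncation_neq0 wsP wN).
have P0 : 0 < normc (gam 0%N) * \prod_(w <- ws N) normc (blaschke r w).[z].
  by rewrite mulr_gt0.
rewrite -(lnK P0) ler_expR lnM ?posrE// ln_prod//.
have := ler_norm (ln (normc (gam 0%N))); rewrite mulrDl.
move: hi lg; lra.
Qed.

End main_estimate.

(** * Complex power series *)

Section complex_power_series.
Variable R : realType.
Implicit Types (c : nat -> R[i]) (z h : R[i]).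

Lemma cvg_cplxP (T : Type) (FF : set_system T) (x : T -> cplx R) (l : cplx R) :
  Filter FF -> (forall e : R, 0 < e -> \forall t \near FF, normc (x t - l) < e) ->
  x t @[t --> FF] --> l.
Proof.
move=> FFF xl; apply/cvgrPdist_lt => e e0.
have eE : e = (Re e)%:C by rewrite RRe_real// gtr0_real.
have := xl (Re e); rewrite -ltcR -eE => /(_ e0).
apply: filterS => t; rewrite normcB => te.
by rewrite [e in _ < e]eE -[`|_|]/((normc _)%:C) ltcR.
Qed.

Lemma cvg_cplx_dist (x : nat -> cplx R) (l : cplx R) (e : R) :
  x n @[n --> \oo] --> l -> 0 < e -> \forall n \near \oo, normc (x n - l) < e.
Proof.
move=> /cvgrPdist_lt xl e0; have := xl e%:C; rewrite ltcR => /(_ e0).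
by apply: filterS => n; rewrite -[`|_|]/((normc _)%:C) ltcR normcB.
Qed.

Definition majorized c := forall r : R, 0 <= r ->
  exists B, forall N, \sum_(n < N) normc (c n) * r ^+ n <= B.

Definition psumc c (z : cplx R) : cplx R :=
  limn (series (fun n => c n * z ^+ n : cplx R)).

Lemma psumc_cvg c z : majorized c ->
  series (fun n => c n * z ^+ n : cplx R) n @[n --> \oo] --> psumc c z.
Proof.
move=> cM; have [B BP] := cM _ (normc_ge0 z).
have nrm (f : R[i] -> R) : (forall y, `|f y| <= normc y) ->
    cvgn (series (fun n => f (c n * z ^+ n))).
  move=> fle; apply: normed_cvg; apply: nondecreasing_is_cvgn.
    by apply: nondecreasing_series => n _ _; exact: normr_ge0.
  exists B => _ [N _ <-].
  rewrite -[leLHS]/(\sum_(0 <= n < N) `|f (c n * z ^+ n)|) big_mkord.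
  rewrite (le_trans _ (BP N))//.
  by apply: ler_sum => n _; rewrite (le_trans (fle _))// normcM normcX.
have /cvg_ex[/= x xP] := nrm (@complex.Re R) (@Re_le_normc R).
have /cvg_ex[/= y yP] := nrm (@complex.Im R) (@Im_le_normc R).
suff H : series (fun n => c n * z ^+ n : cplx R) n @[n --> \oo] --> (x +i* y : cplx R).
  by rewrite /psumc (cvg_lim _ H).
apply: cvg_cplxP => e e0; have e2 : 0 < e / 2 by rewrite divr_gt0.
move/cvgrPdist_lt : xP => /(_ _ e2) xP; move/cvgrPdist_lt : yP => /(_ _ e2) yP.
apply: filterS2 xP yP => n; rewrite /series/= => xn yn.
rewrite (le_lt_trans (normc_le_ReIm _))// [ltRHS](splitr e) ltrD//.
  by rewrite ReD Re_sum /= distrC.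
have ImD (u v : R[i]) : Im (u + v) = Im u + Im v by case: u; case: v.
rewrite ImD /= (big_morph _ ImD (erefl : Im 0 = 0)) distrC//.
Qed.

Lemma psumc_near c z (e : R) : majorized c -> 0 < e ->
  \forall N \near \oo, normc (\sum_(n < N) c n * z ^+ n - psumc c z) < e.
Proof.
move=> cM e0; have := cvg_cplx_dist (@psumc_cvg c z cM) e0.
by apply: filterS => N; rewrite /series/= big_mkord.
Qed.

Lemma psumc_le c z y (B : R) : majorized c ->
  (\forall N \near \oo, normc (\sum_(n < N) c n * z ^+ n - y) <= B) ->
  normc (psumc c z - y) <= B.
Proof.
move=> cM UB; apply/ler_addgt0Pr => e e0.
have [N [/= lN BN]] := filter_ex (filterI (psumc_near z cM e0) UB).
have -> : psumc c z - y = (\sum_(n < N) c n * z ^+ n - y) -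
  (\sum_(n < N) c n * z ^+ n - psumc c z) by ring.
by rewrite (le_trans (normcD _ _))// normcN lerD// ltW.
Qed.

Lemma psumcP c z y : majorized c ->
  (forall e : R, 0 < e ->
    \forall N \near \oo, normc (\sum_(n < N) c n * z ^+ n - y) <= e) ->
  psumc c z = y.
Proof.
move=> cM cy; apply/eqP; rewrite -subr_eq0 -normc_eq0 eq_le normc_ge0 andbT.
apply/ler_addgt0Pr => e e0; rewrite add0r; apply: psumc_le => //.
exact: cy.
Qed.

Definition dcoef c n := n.+1%:R * c n.+1.

Lemma normc_nat n : normc (n%:R : R[i]) = n%:R.
Proof. by rewrite -(rmorph_nat (real_complex R)) normc_real_ge0. Qed.

Lemma mulrn_expr_le (r : R) n : 0 <= r -> n.+1%:R * r ^+ n <= (r + 1) ^+ n.+1.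
Proof.
move=> r0; elim: n => [|n IH]; first by rewrite mul1r expr0 expr1 lerDr.
rewrite [leRHS]exprS [leRHS]mulrDl mul1r -(natr1 n.+1) [leLHS]mulrDl mul1r; apply: lerD.
  by rewrite exprS mulrCA ler_wpM2l.
by rewrite lerXn2r ?nnegrE ?addr_ge0// lerDl.
Qed.

Lemma majorized_dcoef c : majorized c -> majorized (dcoef c).
Proof.
move=> cM r r0; have [B BP] := cM (r + 1) (addr_ge0 r0 ler01).
exists B => N; apply: le_trans (BP N.+1).
rewrite big_ord_recl expr0; apply: ler_wpDl.
  by rewrite mulr_ge0 ?normc_ge0.
apply: ler_sum => n _; rewrite /dcoef normcM normc_nat [_ * normc _]mulrC -mulrA.
by rewrite ler_wpM2l ?normc_ge0// mulrn_expr_le.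
Qed.

Lemma expr_quadratic_remainder z h n : normc h <= 1 ->
  normc ((z + h) ^+ n.+1 - z ^+ n.+1 - n.+1%:R * h * z ^+ n) <=
    normc h ^+ 2 * (normc z + 2) ^+ n.+1.
Proof.
move=> h1; have z0 := normc_ge0 z; have h0 := normc_ge0 h.
elim: n => [|n IH].
  rewrite !expr1 mulr1 mul1r (_ : _ - _ = 0) ?normc0; last by ring.
  by rewrite mulr_ge0 ?sqr_ge0 ?addr_ge0.
have -> : (z + h) ^+ n.+2 - z ^+ n.+2 - n.+2%:R * h * z ^+ n.+1 =
  (z + h) * ((z + h) ^+ n.+1 - z ^+ n.+1 - n.+1%:R * h * z ^+ n) +
  h ^+ 2 * (n.+1%:R * z ^+ n).
  by rewrite -(natr1 n.+1) !exprS; ring.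
rewrite (le_trans (normcD _ _))// !normcM !normcX normc_nat [in leRHS]exprS.
have -> : normc h ^+ 2 * ((normc z + 2) * (normc z + 2) ^+ n.+1) =
  (normc z + 1) * (normc h ^+ 2 * (normc z + 2) ^+ n.+1) +
  normc h ^+ 2 * (normc z + 2) ^+ n.+1 by ring.
apply: lerD.
  apply: ler_pM; rewrite ?normc_ge0//.
  by rewrite (le_trans (normcD _ _))// lerD2l.
rewrite ler_wpM2l ?sqr_ge0// (le_trans (mulrn_expr_le _ z0))//.
by rewrite lerXn2r ?nnegrE ?addr_ge0// lerD2l ler1n.
Qed.

(** The quadratic remainder of each monomial is summed against the majorant at radius [|z| + 2];
    this yields term-by-term differentiation. *)
Lemma psumc_quadratic_remainder c z : majorized c -> exists2 B : R, 0 <= B &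
  forall h, normc h <= 1 ->
  normc (psumc c (z + h) - (psumc c z + h * psumc (dcoef c) z)) <= normc h ^+ 2 * B.
Proof.
move=> cM; have dM := majorized_dcoef cM.
have [B BP] := cM (normc z + 2) (addr_ge0 (normc_ge0 z) (ler0n _ _)).
have B0 : 0 <= B by apply: le_trans (BP 0%N); rewrite big_ord0.
exists B => // h h1.
apply/ler_addgt0Pr => e e0; pose e' := e / 3.
have e'0 : 0 < e' by rewrite divr_gt0.
have [N1 _ P1] := psumc_near (z + h) cM e'0.
have [N2 _ P2] := psumc_near z cM e'0.
have [N3 _ P3] := psumc_near z dM e'0.
pose N := (N1 + N2 + N3)%N.
have a1 := P1 N.+1 (ltac:(rewrite /= /N; lia)).
have a2 := P2 N.+1 (ltac:(rewrite /= /N; lia)).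
have a3 := P3 N (ltac:(rewrite /= /N; lia)).
rewrite /= in a1 a2 a3.
set S1 := \sum_(n < N.+1) _ in a1; set S2 := \sum_(n < N.+1) _ in a2.
set S3 := \sum_(n < N) _ in a3.
have E : normc (S1 - (S2 + h * S3)) <= normc h ^+ 2 * B.
  have -> : S1 - (S2 + h * S3) = \sum_(n < N)
      c n.+1 * ((z + h) ^+ n.+1 - z ^+ n.+1 - n.+1%:R * h * z ^+ n).
    have aux (x p q r : R[i]) : x + p - (x + q + r) = p - q - r by ring.
    rewrite /S1 /S2 /S3 !big_ord_recl !expr0 mulr_sumr aux.
    rewrite -!sumrB; apply: eq_bigr => n _; rewrite /bump/= /dcoef; ring.
  rewrite (le_trans (normc_sum _ _ _))//.
  apply: le_trans (ler_wpM2l (sqr_ge0 _) (BP N.+1)).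
  rewrite big_ord_recl mulrDr; apply: ler_wpDl.
    by rewrite !mulr_ge0 ?exprn_ge0 ?addr_ge0 ?normc_ge0.
  rewrite mulr_sumr; apply: ler_sum => n _; rewrite normcM mulrCA.
  by rewrite ler_wpM2l ?normc_ge0// expr_quadratic_remainder.
have aux (p q r p' q' r' : R[i]) : p' - (q' + h * r') =
  (p - (q + h * r)) - (p - p') + (q - q') + h * (r - r') by ring.
rewrite (aux S1 S2 S3).
have l3 : normc (h * (S3 - psumc (dcoef c) z)) <= e'.
  by rewrite normcM (le_trans _ (ltW a3))// ler_piMl ?normc_ge0.
have l1 := ltW a1; have l2 := ltW a2.
have -> : normc h ^+ 2 * B + e = normc h ^+ 2 * B + e' + e' + e'.
  by rewrite /e'; field.
apply: le_trans (normcD _ _) _; apply: lerD l3.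
apply: le_trans (normcD _ _) _; apply: lerD l2.
by apply: le_trans (normcD _ _) _; rewrite normcN; apply: lerD l1.
Qed.

Lemma derive1_psumc c : majorized c -> derive1 (psumc c) = psumc (dcoef c).
Proof.
move=> cM; apply/funext => z.
have [B B0 BP] := psumc_quadratic_remainder z cM.
apply: (@cvg_lim (cplx R)); first exact: norm_hausdorff.
apply: cvg_cplxP => e e0.
have e1 : 0 < e / (B + 1) by rewrite divr_gt0// ltr_wpDl.
pose d : R := Num.min 1 (e / (B + 1)).
have d0 : 0 < d by rewrite lt_min ltr01.
apply/nbhs_ballP; exists d%:C => /=; first by rewrite ltcR.
move=> h; rewrite /ball/= sub0r normrN -[`|_|]/((normc _)%:C) ltcR lt_min.
move=> /andP[h1 he] hn0; have h0 : 0 < normc h by rewrite normc_gt0.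
have -> : h^-1 *: (psumc c (h + z) - psumc c z) - psumc (dcoef c) z =
    h^-1 * (psumc c (z + h) - (psumc c z + h * psumc (dcoef c) z)) :> R[i].
  by rewrite [h + z]addrC opprD addrA mulrBr mulKf.
rewrite normcM normcV ltr_pdivrMl//.
rewrite (le_lt_trans (BP _ (ltW h1)))// expr2 -mulrA ltr_pM2l//.
move: he; rewrite ltr_pdivlMr ?ltr_wpDl// mulrDr mulr1; lra.
Qed.

Lemma majorized_iter_dcoef c j : majorized c -> majorized (iter j dcoef c).
Proof. by move=> cM; elim: j => //= j; exact: majorized_dcoef. Qed.

Lemma derive1n_psumc c j : majorized c ->
  derive1n j (psumc c) = psumc (iter j dcoef c).
Proof.
move=> cM; elim: j => [//|j IH].
rewrite /derive1n iterS -/(derive1n j _) IH derive1_psumc//.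
exact: majorized_iter_dcoef.
Qed.

Lemma derivn_poly c N j :
  (\poly_(n < N) c n)^`(j) = \poly_(n < N - j) iter j dcoef c n.
Proof.
elim: j => [|j IH]; first by rewrite derivn0 subn0.
rewrite derivnS IH; apply/polyP => i.
rewrite coef_deriv !coef_poly subnS -ltn_predRL; case: ifP => _.
  by rewrite /= /dcoef mulr_natl.
by rewrite mul0rn.
Qed.

End complex_power_series.

(** * The entire function, its maximum modulus and its translates *)

Section nonnegative_coefficients.
Variables (R : realType) (a : nat -> R).
Hypothesis Ka : classK a.
Hypothesis entire_a : entire a.

Local Notation f t := (limn (pseries a t)).

Let a_ge0 n : 0 <= a n. Proof. by case: Ka. Qed.

Lemma entire_pseries_cvg (r : R) : 0 <= r -> cvgn (pseries a r).
Proof.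
move=> r0.
have : (r%:E < cvg_radius a)%E by rewrite entire_a ltry.
case/ereal_sup_gt => _ [x [x0 xcvg] <-]; rewrite lte_fin => rx.
apply: series_le_cvg xcvg => n; rewrite ?mulr_ge0 ?exprn_ge0//.
by rewrite ler_wpM2l// lerXn2r ?nnegrE// ltW.
Qed.

Lemma partial_pseries_le (r : R) N : 0 <= r ->
  \sum_(n < N) a n * r ^+ n <= f r.
Proof.
move=> r0; have nd : nondecreasing_seq (pseries a r).
  by apply: nondecreasing_series => i _ _; rewrite mulr_ge0// exprn_ge0.
have := nondecreasing_cvgn_le nd (entire_pseries_cvg r0) N.
by rewrite /pseries /series/= big_mkord.
Qed.

Lemma pseries_le (r B : R) : 0 <= r ->
  (forall N, \sum_(n < N) a n * r ^+ n <= B) -> f r <= B.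
Proof.
move=> r0 NB; apply: limr_le; first exact: entire_pseries_cvg.
by near=> N; rewrite /pseries /series/= big_mkord.
Unshelve. all: by end_near. Qed.

Lemma pseries_ge0 (r : R) : 0 <= r -> a 0%N <= f r.
Proof.
by move=> r0; have := partial_pseries_le 1 r0; rewrite big_ord1 expr0 mulr1.
Qed.

Lemma pseries_gt0 (r : R) : 0 <= r -> 0 < f r.
Proof. by move=> r0; rewrite (lt_le_trans _ (pseries_ge0 r0))//; case: Ka. Qed.

Definition ccoef (b : R[i]) n : R[i] := (a n)%:C - (if n == 0%N then b else 0).

Lemma ccoef0 b : ccoef b 0 = (a 0%N)%:C - b.
Proof. by []. Qed.

Lemma ccoefS b n : ccoef b n.+1 = (a n.+1)%:C.
Proof. by rewrite /ccoef subr0. Qed.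

Lemma normc_ccoef_sum b N (r : R) : 0 <= r ->
  \sum_(n < N) normc (ccoef b n) * r ^+ n <= f r + normc b.
Proof.
move=> r0.
apply: (@le_trans _ _ (\sum_(n < N.+1) normc (ccoef b n) * r ^+ n)).
  by rewrite big_ord_recr/= lerDl mulr_ge0 ?normc_ge0 ?exprn_ge0.
apply: le_trans (lerD (partial_pseries_le N.+1 r0) (lexx _)).
rewrite !big_ord_recl expr0 !mulr1 addrAC; apply: lerD.
  by rewrite ccoef0 (le_trans (normcD _ _))// normcN normc_real_ge0.
by apply: ler_sum => n _; rewrite ccoefS normc_real_ge0.
Qed.

Lemma majorized_ccoef b : majorized (ccoef b).
Proof. by move=> r r0; exists (f r + normc b) => N; exact: normc_ccoef_sum. Qed.

Lemma psum_psumc : psum a = psumc (ccoef 0).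
Proof.
apply/funext => z; rewrite /psum /psumc /ccoef.
by congr (limn (series _)); apply/funext => n; rewrite if_same subr0.
Qed.

Lemma psum_subE b : (fun z => psum a z - b : cplx R) = psumc (ccoef b).
Proof.
apply/funext => z; apply/esym/psumcP => [|e e0]; first exact: majorized_ccoef.
rewrite psum_psumc; have [N0 _ NP] := psumc_near z (majorized_ccoef 0) e0.
exists N0.+1 => // -[//|N] /= NN; have {}NP := NP N.+1 (leqW NN).
rewrite (le_trans _ (ltW NP))// le_eqVlt; apply/orP; left; apply/eqP; congr normc.
have sumE d : \sum_(n < N.+1) ccoef d n * z ^+ n =
    (a 0%N)%:C - d + \sum_(n < N) (a n.+1)%:C * z ^+ n.+1.
  rewrite big_ord_recl expr0 mulr1 ccoef0; congr (_ + _).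
  by apply: eq_bigr => n _; rewrite ccoefS.
by rewrite !sumE; ring.
Qed.

Lemma normc_psum_le z : normc (psum a z) <= f (normc z).
Proof.
rewrite psum_psumc -(subr0 (psumc _ _)); apply: psumc_le.
  exact: majorized_ccoef.
exists 0%N => // N _ /=; rewrite subr0 (le_trans (normc_sum _ _ _))//.
have := normc_ccoef_sum 0 N (normc_ge0 z); rewrite normc0 addr0.
by apply: le_trans; apply: ler_sum => n _; rewrite normcM normcX.
Qed.

Lemma psum_real (t : R) : 0 <= t -> psum a t%:C = (f t)%:C.
Proof.
move=> t0; rewrite psum_psumc; apply: psumcP => [|e e0].
  exact: majorized_ccoef.
have /cvgrPdist_lt/(_ _ e0) : pseries a t n @[n --> \oo] --> f t.
  exact: entire_pseries_cvg.
apply: filterS => N; rewrite /pseries /series/= big_mkord distrC => /ltW.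
apply: le_trans; rewrite -normc_real le_eqVlt; apply/orP; left; apply/eqP.
congr normc; rewrite rmorphB rmorph_sum/=; congr (_ - _).
by apply: eq_bigr => n _; rewrite /ccoef if_same subr0 rmorphM rmorphXn.
Qed.

Lemma max_modulus_psum (t : R) : 0 <= t -> max_modulus (psum a) t = f t.
Proof.
move=> t0; apply/eqP; rewrite eq_le; apply/andP; split.
  apply: ge_sup.
    by exists (modulus (psum a t%:C)), t%:C => //; exact: normc_real_ge0.
  by move=> _ [z zt <-]; rewrite /modulus (le_trans (normc_psum_le z))// -zt.
apply: ub_le_sup; last first.
  exists t%:C; first exact: normc_real_ge0.
  by rewrite psum_real// /modulus normc_real_ge0// ltW// pseries_gt0.
exists (f t) => _ [z zt <-].
by rewrite /modulus (le_trans (normc_psum_le z))// -zt.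
Qed.

(** [kap] is the multiplicity of the origin as a zero of [f - b]. Dividing by [z ^+ kap] gives the
    nonzero constant term that the root products require, and matches the exclusion of 0 from
    [bvalues]. *)
Lemma ccoef_neq0 b :
  exists kap, ccoef b kap != 0 /\ forall n, (n < kap)%N -> ccoef b n = 0.
Proof.
have [_ _ [m m0 am] _] := Ka.
have : exists n, ccoef b n != 0.
  exists m; rewrite /ccoef ifN ?subr0 -?lt0n//.
  by rewrite fmorph_eq0.
move=> ex; have [kap kP kmin] := ex_minnP ex; exists kap; split => // n nk.
by apply/eqP; apply: contraTT nk => /kmin; rewrite -leqNgt.
Qed.

End nonnegative_coefficients.

Section exceptional_value.
Variables (R : realType) (a : nat -> R).
Hypothesis Ka : classK a.
Hypothesis entire_a : entire a.
Local Notation f t := (limn (pseries a t)).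
Variables (b : R[i]) (s : R) (H : nat) (r0 : R).
Hypothesis s0 : 0 < s.
Hypothesis sH : s <= H.+1%:R.
Hypothesis r01 : 1 <= r0.
Hypothesis fH : forall r, r0 <= r -> ln (f r + normc b) <= r ^+ H.
Hypothesis sum_s :
  (\esum_(p in bvalues (psum a) b) (modulus p.1 `^ (- s))%:E < +oo)%E.

Lemma bvalues_sum_le (t : seq (cplx R * nat)) :
  uniq t -> (forall p, p \in t -> bvalues (psum a) b p) ->
  \sum_(p <- t) normc p.1 `^ (- s) <=
    fine (\esum_(p in bvalues (psum a) b) (modulus p.1 `^ (- s))%:E)%E.
Proof.
move=> ut tb; have := sum_s; set E := esum _ _ => Elt.
have E0 : (0 <= E)%E by apply: esum_ge0 => p _; rewrite lee_fin powR_ge0.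
have Efin : E \is a fin_num by rewrite ge0_fin_numE.
rewrite -lee_fin fineK//; apply: ereal_sup_ubound.
exists [set` t].
  by split; [exact: finite_seq | move=> p /= /tb].
by rewrite -fsbig_seq// sumEFin.
Qed.

Section shifted.
Variables (kap : nat).
Local Notation c := (ccoef a b).
Hypothesis kap0 : c kap != 0.
Hypothesis kap_min : forall n, (n < kap)%N -> c n = 0.
Local Notation gam := (fun n => c (n + kap)%N).
Local Notation F r := (limn (pseries (fun n => normc (gam n)) r)).

Lemma shifted_sum_le N (r : R) : 0 <= r ->
  r ^+ kap * \sum_(n < N) normc (gam n) * r ^+ n <= f r + normc b.
Proof.
move=> rge0; rewrite mulr_sumr.
apply: le_trans (normc_ccoef_sum Ka entire_a b (kap + N) rge0).
rewrite big_split_ord/=; apply: ler_wpDl.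
  by apply: sumr_ge0 => n _; rewrite mulr_ge0 ?normc_ge0 ?exprn_ge0.
by apply: ler_sum => n _; rewrite mulrCA -exprD addnC.
Qed.

Lemma majorized_shifted : majorized gam.
Proof.
move=> r rge0; have r1 : 0 <= r + 1 by rewrite addr_ge0.
exists (f (r + 1) + normc b) => N; apply: le_trans (shifted_sum_le N r1).
apply: (@le_trans _ _ (\sum_(n < N) normc (gam n) * (r + 1) ^+ n)).
  apply: ler_sum => n _; rewrite ler_wpM2l ?normc_ge0// lerXn2r ?nnegrE//.
  by rewrite lerDl.
rewrite ler_peMl//.
  by apply: sumr_ge0 => n _; rewrite mulr_ge0 ?normc_ge0 ?exprn_ge0.
by rewrite exprn_ege1// lerDr.
Qed.

Lemma shifted_pseries_cvg (r : R) : 0 <= r -> cvgn (pseries (fun n => normc (gam n)) r).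
Proof.
move=> rge0; apply: nondecreasing_is_cvgn.
  by apply: nondecreasing_series => i _ _; rewrite mulr_ge0 ?normc_ge0// exprn_ge0.
have [B BP] := majorized_shifted rge0.
by exists B => _ [N _ <-]; rewrite /pseries /series/= big_mkord.
Qed.

Lemma shifted_partial_le N (r : R) : 0 <= r ->
  \sum_(n < N) normc (gam n) * r ^+ n <= F r.
Proof.
move=> rge0; have nd : nondecreasing_seq (pseries (fun n => normc (gam n)) r).
  by apply: nondecreasing_series => i _ _; rewrite mulr_ge0 ?normc_ge0// exprn_ge0.
have := nondecreasing_cvgn_le nd (shifted_pseries_cvg rge0) N.
by rewrite /pseries /series/= big_mkord.
Qed.

Lemma shifted_le (r : R) : 1 <= r -> F r <= f r + normc b.
Proof.
move=> r1; have rge0 := le_trans ler01 r1.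
apply: limr_le; first exact: shifted_pseries_cvg.
near=> N; rewrite /pseries /series/= big_mkord.
apply: le_trans (shifted_sum_le N rge0).
rewrite ler_peMl ?exprn_ege1//.
by apply: sumr_ge0 => n _; rewrite mulr_ge0 ?normc_ge0 ?exprn_ge0.
Unshelve. all: by end_near. Qed.

Lemma psumc_shifted (z : R[i]) : psumc c z = z ^+ kap * psumc gam z.
Proof.
apply: psumcP => [|e e0]; first exact: majorized_ccoef.
have q0 : 0 < normc z ^+ kap + 1.
  by rewrite ltr_wpDl// exprn_ge0 ?normc_ge0.
have e'0 : 0 < e / (normc z ^+ kap + 1) by rewrite divr_gt0.
have [N0 _ NP] := psumc_near z majorized_shifted e'0.
exists (kap + N0)%N => // M /= NM.
have -> : M = (kap + (M - kap))%N by rewrite subnKC// (leq_trans _ NM)// leq_addr.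
rewrite big_split_ord/= big1 ?add0r => [|n _]; last by rewrite kap_min// mul0r.
have -> : \sum_(n < M - kap) c (kap + n)%N * z ^+ (kap + n) =
    z ^+ kap * \sum_(n < M - kap) gam n * z ^+ n.
  by rewrite mulr_sumr; apply: eq_bigr => n _; rewrite exprD mulrCA addnC.
rewrite -mulrBr normcM normcX.
have := NP (M - kap)%N; rewrite /= leq_subRL; last by lia.
move=> /(_ NM); rewrite ltr_pdivlMr// => lt_e.
apply: le_trans (ltW lt_e); rewrite mulrC ler_wpM2l ?normc_ge0//.
by rewrite lerDl.
Qed.

Lemma shifted_truncation N : 'X^kap * truncation gam N = \poly_(n < kap + N.+1) c n.
Proof.
apply/polyP => i; rewrite coefXnM !coef_poly; case: ltnP => ik.
  by rewrite kap_min// if_same.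
by rewrite -ltn_subLR// subnK.
Qed.

Variables (U : set_system nat) (ultraU : UltraFilter U).
Hypothesis U_infty : \oo `<=` U.

(** At a fixed point the derivatives of the truncations converge to those of [f - b], so a zero
    ultralimit makes the latter vanish. The factor [i!] separates ordinary from normalised
    derivatives. *)
Lemma ulim_nderivn_bvalues (x : R[i]) j : x != 0 ->
  (forall i, (i <= j)%N ->
    ulim U (fun N => (('X^kap * truncation gam N)^`N(i)).[x]) 0) ->
  bvalues (psum a) b (x, j).
Proof.
move=> x0 xj; split=> // i /= /xj il.
rewrite psum_subE// derive1n_psumc; last exact: majorized_ccoef.
have dM := majorized_iter_dcoef i (majorized_ccoef Ka entire_a b).
apply/eqP; rewrite -normc_eq0 eq_le normc_ge0 andbT.
apply/ler_addgt0Pr => e e0; rewrite add0r.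
have e2 : 0 < e / 2 by rewrite divr_gt0.
have fe : 0 < e / 2 / i`!%:R by rewrite divr_gt0// ltr0n fact_gt0.
have [N0 _ NP] := psumc_near x dM e2.
have U0 : U [set N | (N0 + i <= N)%N] by apply: U_infty; exists (N0 + i)%N.
have [N [/= Nl NN]] := filter_ex (filterI (il _ fe) U0).
have Ni : (N0 <= kap + N.+1 - i)%N by lia.
have /= := NP _ Ni.
have -> : \sum_(n < kap + N.+1 - i) iter i (@dcoef R) c n * x ^+ n =
    (('X^kap * truncation gam N)^`N(i)).[x] *+ i`!.
  by rewrite -hornerMn -nderivn_def shifted_truncation derivn_poly horner_poly.
move: Nl; rewrite subr0; set y := _.[x] => yl dl.
set l := psumc _ x.
have -> : l = y *+ i`! - (y *+ i`! - l).
  by rewrite opprB addrC subrK.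
rewrite (le_trans (normcD _ _))// normcN [leRHS](splitr e) lerD ?(ltW dl)//.
rewrite -mulr_natr normcM normc_nat -ler_pdivlMr ?ltr0n ?fact_gt0//.
exact: ltW.
Qed.

Lemma shifted_exponential_estimate : exists D : nat -> R[i],
  (forall n, n.+1%:R <= s -> D n = 0) /\
  forall e, 0 < e -> exists C, forall r, r0 <= r ->
    forall z, normc z <= (1 - e) * r ->
      log_poly H D z <= ln (f r + normc b) + C * r `^ s /\
      normc (psum a z - b) <=
        normc z ^+ kap * expR (log_poly H D z + C * r `^ s).
Proof.
pose gm : nat -> R[i] := gam.
have g0 : gm 0%N != 0 by [].
have [ws wsP] := truncation_roots g0.
have FP N r : 0 <= r -> \sum_(n < N) normc (gm n) * r ^+ n <= F r.
  exact: shifted_partial_le.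
have r0P r : r0 <= r -> 1 <= r by exact: le_trans.
have FH r : r0 <= r -> ln (F r) <= r ^+ H.
  move=> rr0; apply: le_trans (fH rr0); have r1 := r0P _ rr0.
  have Fg : 0 < F r by apply: (majorant_gt0 g0 FP); exact: le_trans r1.
  by rewrite ler_ln ?posrE ?shifted_le// (lt_le_trans Fg)// shifted_le.
have wK := truncation_root_sum g0 FP wsP ultraU ulim_nderivn_bvalues bvalues_sum_le.
have UN n : U [set N | (n <= N)%N] by apply: U_infty; exists n.
have gP z : ulim U (fun N => (truncation gam N).[z]) (psumc gam z).
  move=> e e0; apply: U_infty.
  have [N0 _ NP] := psumc_near z majorized_shifted e0.
  exists N0 => // N /= NN; rewrite horner_poly; apply: NP => /=; exact: leqW.
have [D [Ds DP]] := exponential_estimate g0 FP wsP ultraU UN s0 sH r01 FH wK gP.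
exists D; split => // e e0; have [C CP] := DP e e0; exists C => r rr0 z zr.
have r1 := r0P _ rr0.
have Fg : 0 < F r by apply: (majorant_gt0 g0 FP); exact: le_trans r1.
have [lo hi] := CP r rr0 z zr; split.
  rewrite (le_trans lo)// lerD2r ler_ln ?posrE ?shifted_le//.
  by rewrite (lt_le_trans Fg)// shifted_le.
have -> : psum a z - b = z ^+ kap * psumc gam z.
  by rewrite -psumc_shifted -(psum_subE Ka entire_a b).
by rewrite normcM normcX ler_wpM2l ?exprn_ge0 ?normc_ge0.
Qed.

End shifted.

Lemma exceptional_estimate : exists kap : nat, exists D : nat -> R[i],
  (forall n, n.+1%:R <= s -> D n = 0) /\
  forall e, 0 < e -> exists C, forall r, r0 <= r ->
    forall z, normc z <= (1 - e) * r ->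
      log_poly H D z <= ln (f r + normc b) + C * r `^ s /\
      normc (psum a z - b) <=
        normc z ^+ kap * expR (log_poly H D z + C * r `^ s).
Proof.
have [kap [kap0 kmin]] := ccoef_neq0 Ka b.
have [U [ultraU UP]] := ultraFilterLemma eventually_filter.
by exists kap; exact: (shifted_exponential_estimate kap0 kmin ultraU UP).
Qed.

End exceptional_value.

(** * Regular growth *)

Section regular_growth.
Variables (R : realType) (a : nat -> R).
Hypothesis Ka : classK a.
Hypothesis entire_a : entire a.
Local Notation f t := (limn (pseries a t)).

Lemma growth_order_le (s C T : R) : 0 < s ->
  (forall t, T <= t -> ln (f t) <= C * t `^ s) ->
  (growth_order (psum a) <= s%:E)%E.
Proof.
move=> s0 fC; apply/lee_addgt0Pr => e e0.
pose C1 := `|C| + 1.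
have C11 : 1 <= C1 by rewrite lerDr.
have C10 := lt_le_trans ltr01 C11.
pose T1 := Num.max 1 (Num.max T (expR (ln C1 / e))).
rewrite /growth_order limf_esupE.
apply: (@le_trans _ _ (ereal_sup ((fun t : R =>
    (ln (ln (max_modulus (psum a) t)) / ln t)%:E) @` [set t | T1 < t]))).
  apply: ereal_inf_lbound; exists [set t | T1 < t] => //.
  by exists T1; split; [exact: num_real|].
apply: ge_ereal_sup => _ [t /= tT <-].
move: tT; rewrite !gt_max => /andP[t1 /andP[tT te]].
have t0 := lt_trans ltr01 t1.
have lt0 : 0 < ln t by rewrite ln_gt0.
rewrite max_modulus_psum// ?(ltW t0)// -EFinD lee_fin ler_pdivrMr// mulrDl.
have lC : ln C1 <= e * ln t.
  rewrite mulrC -ler_pdivrMr// -(expRK (_ / _)) ler_ln ?posrE ?expR_gt0//.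
  exact: ltW.
(* When [ln (f t)] is nonpositive, its logarithm has the default value 0. *)
have [lf|lf] := leP (ln (f t)) 0.
  by rewrite ln0// addr_ge0// mulr_ge0// ltW.
have ts0 : 0 < t `^ s by rewrite powR_gt0.
have : ln (ln (f t)) <= ln (C1 * t `^ s).
  rewrite ler_ln ?posrE ?mulr_gt0// (le_trans (fC t (ltW tT)))//.
  by rewrite ler_pM2r// (le_trans (ler_norm _))// lerDl.
rewrite lnM ?posrE// ln_powR; lra.
Qed.

Lemma growth_order_lty : (growth_order (psum a) < +oo)%E ->
  exists H1 T : R, forall t, T < t -> ln (ln (f t)) <= H1 * ln t.
Proof.
rewrite /growth_order limf_esupE => /ereal_inf_lt[_ [V [M [_ MV]] <-]] Vlt.
have [H1 H1P] : exists H1 : R, (ereal_sup ((fun t : R =>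
    (ln (ln (max_modulus (psum a) t)) / ln t)%:E) @` V) <= H1%:E)%E.
  by case: ereal_sup Vlt => [x _|//|_]; [exists x|exists 0; rewrite leNye].
exists H1, (Num.max 1 M) => t; rewrite gt_max => /andP[t1 tM].
have t0 := lt_trans ltr01 t1.
rewrite -ler_pdivrMr ?ln_gt0// -lee_fin -(max_modulus_psum Ka entire_a (ltW t0)).
apply: le_trans H1P; apply: ereal_sup_ubound; exists t => //; exact: MV.
Qed.

Lemma ln_add_le (t y : R) : 0 <= t -> 0 <= y ->
  ln (f t + y) <= ln (f t) + y / a 0%N.
Proof.
move=> t0 y0; have a0 : 0 < a 0%N by case: Ka.
have fa := pseries_ge0 Ka entire_a t0.
have f0 := pseries_gt0 Ka entire_a t0.
have -> : f t + y = f t * (1 + y / f t).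
  by rewrite mulrDr mulr1 mulrCA divff ?mulr1// gt_eqF.
have y1 : 0 <= y / f t by rewrite divr_ge0// ltW.
rewrite lnM ?posrE ?ltr_pwDl// lerD2l (le_trans (le_ln1Dx _))//.
  by rewrite (lt_le_trans _ y1)// ltrN10.
by rewrite ler_wpM2l// lef_pV2 ?posrE.
Qed.

Lemma ln_pseries_le (y s : R) : (growth_order (psum a) < +oo)%E -> 0 <= y ->
  exists H : nat, s <= H.+1%:R /\
  exists2 r0 : R, 1 <= r0 & forall r, r0 <= r -> ln (f r + y) <= r ^+ H.
Proof.
move=> /growth_order_lty[H1 [T HT]] y0.
have a0 : 0 < a 0%N by case: Ka.
pose H2 := Num.max 0 (Num.max s H1); pose h := (Num.truncn H2).+1.
have H20 : 0 <= H2 by rewrite le_max lexx.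
have hH : H2 <= h%:R by exact/ltW/truncnS_gt.
have sH : s <= H2 by rewrite !le_max lexx orbT.
(* The power [h] dominates [ln f]. One further power of [r], with [r] at least [B], absorbs the cost
   [y / a 0] of adding [y], hence the exponent [h.+1]. *)
have H1H : H1 <= H2 by rewrite !le_max lexx !orbT.
exists h.+1; split; first by rewrite (le_trans sH)// (le_trans hH)// ler_nat; lia.
pose B := 1 + y / a 0%N.
have B1 : 1 <= B by rewrite lerDl divr_ge0// ltW.
exists (Num.max (T + 1) B); first by rewrite le_max B1 orbT.
move=> r; rewrite ge_max => /andP[rT rB].
have r1 := le_trans B1 rB; have rgt0 := lt_le_trans ltr01 r1.
rewrite (le_trans (ln_add_le (ltW rgt0) y0))//.
have lf : ln (f r) <= r ^+ h.
  have [lf|lf] := leP (ln (f r)) 0; first by rewrite (le_trans lf)// exprn_ge0// ltW.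
  rewrite -[leLHS]lnK ?posrE// -powR_mulrn ?(ltW rgt0)//.
  rewrite /powR gt_eqF// ler_expR (le_trans (HT r _))//; first by lra.
  by rewrite ler_wpM2r ?ln_ge0// (le_trans H1H).
rewrite exprS; have rh : 1 <= r ^+ h by rewrite exprn_ege1.
have := ler_wpM2r (le_trans ler01 rh) rB; rewrite /B => le1.
apply: (le_trans _ le1).
rewrite mulrDl mul1r; apply: lerD => //.
by rewrite ler_peMr// divr_ge0// ltW.
Qed.

Lemma exists_direction (d : R[i]) n : d != 0 ->
  exists2 zeta : R[i], normc zeta = 1 & zeta ^+ n.+1 * d = - (normc d)%:C.
Proof.
move=> d0; have nd0 : 0 < normc d by rewrite normc_gt0.
pose w := - (normc d)%:C / d.
exists (n.+1.-root w); last by rewrite rootCK// /w divfK.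
apply/eqP; rewrite -(@pexpr_eq1 _ _ n.+1) ?normc_ge0// -normcX rootCK//.
rewrite /w normcM normcN normcV normc_real_ge0 ?normc_ge0//.
by rewrite divff// gt_eqF.
Qed.

Lemma log_poly_top (H q : nat) (D : nat -> R[i]) (z : R[i]) (t : R) :
  (q < H)%N -> (forall n, (q < n)%N -> (n < H)%N -> D n = 0) ->
  1 <= t -> normc z <= t ->
  `|log_poly H D z + Re (z ^+ q.+1 * D q) / q.+1%:R| <=
    (\sum_(n < q) normc (D n)) * t ^+ q.
Proof.
move=> qH Dq t1 zt; rewrite /log_poly.
have t0 := lt_le_trans ltr01 t1.
have -> : \sum_(n < H) Re (z ^+ n.+1 * D n) / n.+1%:R =
  \sum_(n < q.+1) Re (z ^+ n.+1 * D n) / n.+1%:R.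
  rewrite -!(big_mkord xpredT (fun n => Re (z ^+ n.+1 * D n) / n.+1%:R)).
  rewrite (big_cat_nat (leq0n q.+1) qH)/= [X in _ + X]big1_seq ?addr0//.
  move=> n; rewrite /= mem_index_iota => /andP[qn nH].
  by rewrite Dq// mulr0 mul0r.
rewrite big_ord_recr/= opprD addrNK normrN.
rewrite (le_trans (ler_norm_sum _ _ _))// mulr_suml; apply: ler_sum => n _.
rewrite normrM normfV normr_nat ler_pdivrMr ?ltr0n//.
rewrite (le_trans (Re_le_normc _))// normcM normcX mulrC.
rewrite -mulrA ler_wpM2l ?normc_ge0//.
apply: (@le_trans _ _ (t ^+ n.+1)).
  by rewrite lerXn2r ?nnegrE ?normc_ge0 ?(ltW t0).
apply: (@le_trans _ _ (t ^+ q)); first by rewrite ler_weXn2l.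
by rewrite ler_peMr ?exprn_ge0 ?(ltW t0)// ler1n.
Qed.

End regular_growth.

Section regular_growth_bounds.
Variables (R : realType) (a : nat -> R).
Hypothesis Ka : classK a.
Hypothesis entire_a : entire a.
Local Notation f t := (limn (pseries a t)).

Lemma borel_exceptional_exponent b : borel_exceptional (psum a) b ->
  exists s : R, [/\ 0 < s,
    (\esum_(p in bvalues (psum a) b) (modulus p.1 `^ (- s))%:E < +oo)%E &
    (s%:E < growth_order (psum a))%E].
Proof. by case/ereal_inf_lt => _ [s [s0 sfin] <-] slt; exists s. Qed.

Lemma expr_le_powR (t sg : R) n : 1 <= t -> n%:R <= sg -> t ^+ n <= t `^ sg.
Proof.
move=> t1 nsg; rewrite -powR_mulrn ?(le_trans ler01 t1)//.
exact: ler_powR.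
Qed.

(** Since [t^kap e^X] is at least 1, adding [b] back costs a factor [1 + |b|]; its logarithm and
    [kap ln t] are both absorbed by [t^sg]. *)
Lemma pseries_upper (b : R[i]) kap (X t sg : R) : 1 <= t -> 0 < sg -> 0 <= X ->
  normc (psum a t%:C - b) <= normc t%:C ^+ kap * expR X ->
  ln (f t) <= X + (ln (1 + normc b) + kap%:R / sg) * t `^ sg.
Proof.
move=> t1 sg0 X0; have t0 := lt_le_trans ltr01 t1.
have b0 := normc_ge0 b.
rewrite normc_real_ge0 ?(ltW t0)// psum_real// ?(ltW t0)// => fb.
have f0 := pseries_gt0 Ka entire_a (ltW t0).
have tX : 1 <= t ^+ kap * expR X.
  by rewrite mulr_ege1 ?exprn_ege1// -expR0 ler_expR.
have ft : f t <= (1 + normc b) * (t ^+ kap * expR X).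
  have -> : f t = normc ((f t)%:C - b + b) by rewrite subrK normc_real_ge0// ltW.
  rewrite (le_trans (normcD _ _))// mulrDl mul1r lerD// ler_peMr//.
have b1 : 0 < 1 + normc b by rewrite ltr_pwDl.
have : ln (f t) <= ln ((1 + normc b) * (t ^+ kap * expR X)).
  by rewrite ler_ln ?posrE// (lt_le_trans f0).
have tk0 : 0 < t ^+ kap by rewrite exprn_gt0.
rewrite lnM ?posrE ?mulr_gt0 ?expR_gt0// lnM ?posrE ?expR_gt0//.
rewrite expRK lnXn// -mulr_natl => /le_trans; apply.
have tsg1 : 1 <= t `^ sg.
  by rewrite -(expr0 t); apply: expr_le_powR => //; exact: ltW.
have l1 : ln (1 + normc b) <= ln (1 + normc b) * t `^ sg.
  by rewrite ler_peMr// ln_ge0// lerDl.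
have l2 : kap%:R * ln t <= kap%:R / sg * t `^ sg.
  by rewrite -mulrA ler_wpM2l ?ler0n// ln_le_powR.
by rewrite mulrDl; lra.
Qed.

(** The asymmetry reflects the estimate of the roots, which holds only strictly inside the disk: the
    lower bound loses [1 - e], with a constant that depends on [e]. In the upper bound this loss is
    removed by enlarging the disk. *)
Definition regular_growth (A sg : R) (Q : nat) (T : R) :=
  (exists C, forall t, T <= t -> ln (f t) <= A * t ^+ Q + C * t `^ sg) /\
  forall e, 0 < e -> e < 1 -> exists C, forall t, T <= t ->
    A * ((1 - e) * t) ^+ Q - C * t `^ sg <= ln (f t).

Lemma exceptional_regular_growth (b : R[i]) :
  (growth_order (psum a) < +oo)%E -> borel_exceptional (psum a) b ->
  exists A sg Q T, [/\ 0 < A, 0 < sg, sg < Q%:R, 1 <= T & regular_growth A sg Q T].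
Proof.
move=> fin /borel_exceptional_exponent[s [s0 sfin slt]].
have nb0 := normc_ge0 b.
have [H [sH [r0 r01 fH]]] := ln_pseries_le Ka entire_a s fin nb0.
have [kap [D [Ds DP]]] := exceptional_estimate Ka entire_a s0 sH r01 fH sfin.
have e20 : 0 < 2^-1 :> R by rewrite invr_gt0.
(* Taking [e = 1/2] and the radius [2 t] puts the point [t] itself in the admissible disk; the
   factor [2^s] goes into the constant. *)
have upper : exists C, forall t, r0 <= t ->
    normc (psum a t%:C - b) <=
    normc t%:C ^+ kap * expR (log_poly H D t%:C + C * t `^ s).
  have [C CP] := DP _ e20; exists (C * 2 `^ s) => t t0.
  have t1 := le_trans r01 t0; have tgt0 := lt_le_trans ltr01 t1.
  have t2 : r0 <= 2 * t by rewrite (le_trans t0)// ler_peMl ?(ltW tgt0)// ler1n.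
  have tz : normc t%:C <= (1 - 2^-1) * (2 * t).
    by rewrite normc_real_ge0 ?(ltW tgt0)//; lra.
  by have [_] := CP _ t2 _ tz; rewrite powRM ?(ltW tgt0)// mulrA.
case: (pselect (exists n, (n < H)%N && (D n != 0))) => [exD|nD]; last first.
  have [C CP] := upper.
  have lp0 z : log_poly H D z = 0.
    rewrite /log_poly big1 ?oppr0// => n _.
    have [->|Dn] := eqVneq (D n) 0; first by rewrite mulr0 mul0r.
    by exfalso; apply: nD; exists n; rewrite ltn_ord.
  (* With no coefficient left, [ln f(t) = O(t^s)] and the order would be at most [s]. *)
  exfalso; move: slt; apply/negP; rewrite -leNgt.
  apply: (@growth_order_le _ a Ka entire_a s
    (`|C| + (ln (1 + normc b) + kap%:R / s)) r0 s0) => t t0.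
  have t1 := le_trans r01 t0.
  rewrite mulrDl; apply: (@pseries_upper b) => //.
    by rewrite mulr_ge0// powR_ge0.
  rewrite (le_trans (CP t t0))// ler_wpM2l ?exprn_ge0 ?normc_ge0//.
  by rewrite ler_expR lp0 add0r ler_wpM2r ?powR_ge0// ler_norm.
have [q /andP[qH Dq0] qmax] := ex_maxnP exD (fun n => fun h => ltnW (proj1 (andP h))).
have Dq n : (q < n)%N -> (n < H)%N -> D n = 0.
  move=> qn nH; apply/eqP; apply: contraTT qn => Dn; rewrite -leqNgt.
  by apply: qmax; rewrite nH.
have sq : s < q.+1%:R.
  by rewrite ltNge; apply: contra Dq0 => /Ds ->.
have nDq : 0 < normc (D q) by rewrite normc_gt0.
pose A := normc (D q) / q.+1%:R.
pose L := \sum_(n < q) normc (D n).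
have L0 : 0 <= L by apply: sumr_ge0 => n _; exact: normc_ge0.
(* The errors are [t^s] from the roots and [t^q] from the terms below the leading one. Both
   exponents are smaller than [q.+1], the first because [D] vanishes whenever [n.+1 <= s]. *)
pose sg := Num.max s q%:R.
have ssg : s <= sg by rewrite le_max lexx.
have qsg : q%:R <= sg by rewrite le_max lexx orbT.
have sg0 : 0 < sg by exact: lt_le_trans ssg.
have ReA (z : R[i]) : `|Re (z ^+ q.+1 * D q) / q.+1%:R| <= A * normc z ^+ q.+1.
  rewrite normrM normfV normr_nat /A mulrAC ler_wpM2r ?invr_ge0//.
  by rewrite (le_trans (Re_le_normc _))// normcM normcX mulrC.
exists A, sg, q.+1, r0; split => //.
- by rewrite divr_gt0.
- by rewrite gt_max sq ltr_nat ltnSn.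
split.
  have [C CP] := upper.
  exists (L + `|C| + (ln (1 + normc b) + kap%:R / sg)) => t t0.
  have t1 := le_trans r01 t0; have tgt0 := lt_le_trans ltr01 t1.
  have tq := expr_le_powR t1 qsg.
  have ts : t `^ s <= t `^ sg by exact: ler_powR.
  pose X := A * t ^+ q.+1 + (L + `|C|) * t `^ sg.
  rewrite [X in _ + X]mulrDl addrA; apply: (@pseries_upper b) => //.
    by rewrite addr_ge0 ?mulr_ge0 ?addr_ge0 ?powR_ge0 ?exprn_ge0 ?(ltW tgt0)// ltW.
  rewrite (le_trans (CP t t0))// ler_wpM2l ?exprn_ge0 ?normc_ge0// ler_expR.
  have tz : normc t%:C <= t by rewrite normc_real_ge0 ?(ltW tgt0).
  have := log_poly_top qH Dq t1 tz; rewrite -/L => top.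
  have := ReA t%:C; rewrite normc_real_ge0 ?(ltW tgt0)// => RA.
  have l1 := ler_wpM2l L0 tq.
  have l2 := ler_wpM2l (normr_ge0 C) ts.
  have l3 : C * t `^ s <= `|C| * t `^ s by rewrite ler_wpM2r ?powR_ge0// ler_norm.
  move: top RA; rewrite !ler_norml => /andP[_ top] /andP[RA _].
  rewrite (mulrDl L); move: l1 l2 l3 top RA.
  move: (Re _ / _) (A * _) (L * _) (L * _) (`|C| * _) (`|C| * _) (C * _) => *; lra.
move=> e e0 e1; have [C CP] := DP e e0.
exists (L + `|C| + normc b / a 0%N) => t t0.
have t1 := le_trans r01 t0; have tgt0 := lt_le_trans ltr01 t1.
have tq := expr_le_powR t1 qsg.
have ts : t `^ s <= t `^ sg by exact: ler_powR.
have t1sg : 1 <= t `^ sg.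
  by rewrite -(expr0 t); apply: expr_le_powR => //; exact: ltW.
have et0 : 0 <= (1 - e) * t by rewrite mulr_ge0 ?(ltW tgt0)// subr_ge0 ltW.
have [zeta z1 zD] := exists_direction q Dq0.
pose z := ((1 - e) * t)%:C * zeta.
have zt : normc z = (1 - e) * t by rewrite normcM z1 mulr1 normc_real_ge0.
have zt' : normc z <= t by rewrite zt ler_piMl ?(ltW tgt0)// gerBl ltW.
have zle : normc z <= (1 - e) * t by rewrite zt.
have [lo _] := CP t t0 z zle.
have := log_poly_top qH Dq t1 zt'; rewrite -/L.
have -> : Re (z ^+ q.+1 * D q) / q.+1%:R = - (A * ((1 - e) * t) ^+ q.+1).
  rewrite exprMn -mulrA zD mulrN -rmorphXn -rmorphM -rmorphN/=.
  by rewrite /A; field; rewrite addrC natr1 pnatr_eq0.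
rewrite ler_norml => /andP[top _].
have l1 := ler_wpM2l L0 tq.
have l2 := ler_wpM2l (normr_ge0 C) ts.
have l3 : C * t `^ s <= `|C| * t `^ s by rewrite ler_wpM2r ?powR_ge0// ler_norm.
have a0 : 0 < a 0%N by case: Ka.
have l4 : normc b / a 0%N <= normc b / a 0%N * t `^ sg.
  by rewrite ler_peMr// divr_ge0// ltW.
have l5 := ln_add_le Ka entire_a (ltW tgt0) nb0.
rewrite (mulrDl _ (normc b / a 0%N)) (mulrDl L); move: l1 l2 l3 l4 l5 lo top.
move: (A * _) (L * _) (L * _) (`|C| * _) (`|C| * _) (C * _) => *.
lra.
Qed.

End regular_growth_bounds.

(** * Concentration of the Khinchin family *)

Section khinchin_expectation.
Variables (R : realType) (a : nat -> R) (t : R).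
Hypothesis Ka : classK a.
Hypothesis entire_a : entire a.
Hypothesis t0 : 0 < t.
Local Notation f t := (limn (pseries a t)).
Local Notation P := (khinchin_law a t).
Local Open Scope ereal_scope.
Implicit Types g : nat -> R.

Let f0 : (0 < f t)%R. Proof. by apply: pseries_gt0 => //; exact: ltW. Qed.

Lemma khinchin_lawE (U : set nat) :
  P U = \esum_(n in U) (khinchin_pmf a t n)%:E.
Proof.
rewrite /khinchin_law ifT//; apply/asboolP; split => //.
by apply: entire_pseries_cvg => //; exact: ltW.
Qed.

Lemma khinchin_pmf_nonneg n : (0 <= khinchin_pmf a t n)%R.
Proof.
apply: khinchin_pmf_ge0 => //.
by apply: entire_pseries_cvg => //; exact: ltW.
Qed.

Lemma khinchin_expectationE g : (forall n, 0 <= g n)%R ->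
  expectation P g = \sum_(n <oo) (g n * khinchin_pmf a t n)%:E.
Proof.
move=> g0; rewrite unlock.
have <- : \bigcup_k [set k] = [set: nat] by apply/seteqP; split=> // n _; exists n.
rewrite ge0_integral_bigcup//; first last.
- by move=> i j _ _ [x [<- <-]].
- by move=> x _; rewrite lee_fin.
apply: eq_eseriesr => n _.
rewrite (eq_integral (fun=> (g n)%:E)) => [|x]; last first.
  by rewrite inE/= => ->.
rewrite integral_cst// EFinM; congr (_ * _).
by rewrite [LHS]khinchin_lawE esum_set1// lee_fin khinchin_pmf_nonneg.
Qed.

Lemma khinchin_expectation_le g1 g2 : (forall n, 0 <= g1 n)%R ->
  (forall n, g1 n <= g2 n)%R -> expectation P g1 <= expectation P g2.
Proof.
move=> g10 g12; have g20 n : (0 <= g2 n)%R by exact: le_trans (g12 n).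
rewrite !khinchin_expectationE//; apply: lee_nneseries => n _.
  by rewrite lee_fin mulr_ge0 ?khinchin_pmf_nonneg.
by rewrite lee_fin ler_wpM2r ?khinchin_pmf_nonneg.
Qed.

Lemma khinchin_expectationD g1 g2 : (forall n, 0 <= g1 n)%R ->
  (forall n, 0 <= g2 n)%R ->
  expectation P (fun n => g1 n + g2 n)%R = expectation P g1 + expectation P g2.
Proof.
move=> g10 g20; rewrite !khinchin_expectationE//; last first.
  by move=> n; rewrite addr_ge0.
rewrite -nneseriesD; first last.
- by move=> n _; rewrite lee_fin mulr_ge0 ?khinchin_pmf_nonneg.
- by move=> n _; rewrite lee_fin mulr_ge0 ?khinchin_pmf_nonneg.
by apply: eq_eseriesr => n _; rewrite mulrDl EFinD.
Qed.

Lemma khinchin_expectationZ (k : R) g : (0 <= k)%R -> (forall n, 0 <= g n)%R ->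
  expectation P (fun n => k * g n)%R = k%:E * expectation P g.
Proof.
move=> k0 g0; rewrite !khinchin_expectationE//; last first.
  by move=> n; rewrite mulr_ge0.
rewrite -nneseriesZl => [|n _]; last by rewrite lee_fin mulr_ge0 ?khinchin_pmf_nonneg.
by apply: eq_eseriesr => n _; rewrite -mulrA EFinM.
Qed.

Lemma khinchin_expectation_exp (h : R) :
  expectation P (fun n => expR (h * n%:R)) = (f (t * expR h) / f t)%:E.
Proof.
have th0 : (0 <= t * expR h)%R by rewrite mulr_ge0 ?expR_ge0 ?ltW.
rewrite khinchin_expectationE; last by move=> n; exact: expR_ge0.
have cv : pseries a (t * expR h) n @[n --> \oo] --> f (t * expR h).
  exact: entire_pseries_cvg.
apply/cvg_lim => //.
rewrite (_ : (fun n => _) = EFin \o (fun n => pseries a (t * expR h) n / f t)%R).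
  by apply: cvg_EFin; [near=> x|apply: cvgMr_tmp].
apply/funext => n /=; rewrite sumEFin /pseries /series/= mulr_suml; congr EFin.
apply: eq_bigr => k _; rewrite /khinchin_pmf exprMn.
by have -> : (expR h ^+ k = expR (h * k%:R))%R; [rewrite mulrC expRM_natl|ring].
Unshelve. all: by end_near. Qed.

End khinchin_expectation.

Section khinchin_dispersion.
Variables (R : realType) (a : nat -> R) (t : R).
Hypothesis Ka : classK a.
Hypothesis entire_a : entire a.
Hypothesis t0 : 0 < t.
Local Notation P := (khinchin_law a t).
Implicit Types g : nat -> R.

Lemma khinchin_expectation_comb_le g1 g2 (k x1 x2 : R) : 0 <= k ->
  (forall n, 0 <= g1 n) -> (forall n, 0 <= g2 n) ->
  (expectation P g1 <= x1%:E)%E -> (expectation P g2 <= x2%:E)%E ->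
  (expectation P (fun n => g1 n + k * g2 n)%R <= (x1 + k * x2)%:E)%E.
Proof.
move=> k0 g10 g20 E1 E2.
rewrite khinchin_expectationD// => [|n]; last by rewrite mulr_ge0.
rewrite khinchin_expectationZ// EFinD EFinM leeD//.
by rewrite lee_wpmul2l// lee_fin.
Qed.

Lemma khinchin_expectation_cst (x : R) : expectation P (fun=> x) = x%:E.
Proof. exact: (expectation_cst P). Qed.

(** A small relative second moment about [y] puts the mean within [y e] of [y], so the mean is at
    least [y / 2], and bounds the deviation by [2 y e]; the quotient is [4 e]. *)
Lemma khinchin_std_mean_le (y e : R) : 0 < y -> 0 < e -> e <= 2^-1 ->
  (expectation P (fun n : nat => ((n%:R - y) / y) ^+ 2 : R)%R <= (e ^+ 2)%:E)%E ->
  khinchin_std a t / khinchin_mean a t <= 4 * e.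
Proof.
move=> y0 e0 e12 Ey.
pose u (n : nat) : R := (n%:R - y) / y.
have yu n : y * u n = n%:R - y by rewrite /u mulrC divfK// gt_eqF.
have Eu : (expectation P (fun n => `|u n|)%R <= e%:E)%E.
  (* The pointwise inequality between arithmetic and geometric means replaces Cauchy-Schwarz. *)
  apply: (@le_trans _ _ (expectation P (fun n => e / 2 + (2 * e)^-1 * u n ^+ 2)%R)).
    apply: khinchin_expectation_le => // n.
    rewrite -[u n ^+ 2]real_normK ?num_real//; set v := `|u n|.
    have -> : e / 2 + (2 * e)^-1 * v ^+ 2 = (2 * e)^-1 * (e ^+ 2 + v ^+ 2).
      by field; rewrite gt_eqF.
    rewrite ler_pdivlMl ?mulr_gt0//; have := sqr_ge0 (e - v); rewrite sqrrB; lra.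
  have -> : e%:E = (e / 2 + (2 * e)^-1 * e ^+ 2)%:E.
    by congr EFin; field; rewrite gt_eqF.
  apply: khinchin_expectation_comb_le => //.
  - by rewrite invr_ge0 mulr_ge0// ltW.
  - by move=> n; rewrite divr_ge0// ltW.
  - by move=> n; exact: sqr_ge0.
  - by rewrite khinchin_expectation_cst.
set m := khinchin_mean a t.
have En0 : (0 <= expectation P (fun n : nat => n%:R : R)%R)%E.
  by apply: expectation_ge0 => n; exact: ler0n.
have Enle : (expectation P (fun n : nat => n%:R : R)%R <= (y + y * e)%:E)%E.
  apply: (@le_trans _ _ (expectation P (fun n => y + y * `|u n|)%R)).
    apply: khinchin_expectation_le => // n.
    by have := ler_wpM2l (ltW y0) (ler_norm (u n)); rewrite yu; lra.
  apply: khinchin_expectation_comb_le => //; first exact: ltW.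
  - by move=> n; exact: ltW.
  - by rewrite khinchin_expectation_cst.
have mE : expectation P (fun n : nat => n%:R : R)%R = m%:E.
  rewrite /m /khinchin_mean fineK// ge0_fin_numE//.
  by rewrite (le_lt_trans Enle)// ltry.
have m_le : m <= y + y * e by rewrite -lee_fin -mE.
have m_ge : y <= m + y * e.
  rewrite -lee_fin -[leLHS](khinchin_expectation_cst y).
  apply: (@le_trans _ _ (expectation P (fun n : nat => n%:R + y * `|u n|)%R)).
    apply: khinchin_expectation_le => // n; first exact: ltW.
    have := ler_wpM2l (ltW y0) (ler_norm (- u n)); rewrite normrN mulrN yu; lra.
  apply: (@khinchin_expectation_comb_le (fun n => n%:R) (fun n => `|u n|)) => //.
    exact: ltW.
  by rewrite mE.
have V0 : (0 <= variance P (fun n : nat => n%:R : R)%R)%E.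
  by rewrite /variance unlock; apply: expectation_ge0 => n; rewrite -expr2 sqr_ge0.
have Vle : (variance P (fun n : nat => n%:R : R)%R <=
    (2 * (y * e) ^+ 2 + 2 * y ^+ 2 * e ^+ 2)%:E)%E.
  rewrite /variance unlock -/(khinchin_mean a t) -/m.
  apply: (@le_trans _ _ (expectation P
      (fun n : nat => 2 * (y * e) ^+ 2 + 2 * y ^+ 2 * u n ^+ 2)%R)).
    apply: khinchin_expectation_le => // n /=.
      by rewrite -expr2 sqr_ge0.
    have -> : 2 * y ^+ 2 * u n ^+ 2 = 2 * (n%:R - y) ^+ 2 by rewrite -mulrA -exprMn yu.
    have me : (m - y) ^+ 2 <= (y * e) ^+ 2.
      have ye0 : 0 <= y * e by rewrite mulr_ge0// ltW.
      rewrite -[leLHS]real_normK ?num_real// lerXn2r ?nnegrE// ler_norml.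
      by apply/andP; split; lra.
    have key (x : R) : (x - m) ^+ 2 <= 2 * (y * e) ^+ 2 + 2 * (x - y) ^+ 2.
      have := sqr_ge0 ((x - y) + (m - y)); move: me.
      by move: ((y * e) ^+ 2) => z; rewrite !expr2; lra.
    exact: key.
  apply: khinchin_expectation_comb_le => //.
  - by rewrite mulr_ge0// sqr_ge0.
  - by move=> n; rewrite mulr_ge0 ?sqr_ge0.
  - by move=> n; exact: sqr_ge0.
  - by rewrite khinchin_expectation_cst.
have Vfin : variance P (fun n : nat => n%:R : R)%R = (khinchin_var a t)%:E.
  by rewrite /khinchin_var fineK// ge0_fin_numE// (le_lt_trans Vle)// ltry.
rewrite Vfin lee_fin in Vle.
have std_le : khinchin_std a t <= 2 * (y * e).
  have ye0 : 0 <= 2 * (y * e) by rewrite !mulr_ge0// ltW.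
  rewrite /khinchin_std -(ger0_norm ye0) -sqrtr_sqr ler_wsqrtr//.
  by rewrite (le_trans Vle)// le_eqVlt; apply/orP; left; apply/eqP; ring.
have ye : y * e <= y / 2 by rewrite ler_wpM2l// ltW.
have m0 : 0 < m by lra.
rewrite ler_pdivrMr// (le_trans std_le)//.
have em : e * (y / 2) <= e * m by rewrite ler_wpM2l// ?(ltW e0)//; lra.
lra.
Qed.

End khinchin_dispersion.

(** * Chernoff bounds from regular growth *)

Section clan_of_regular_growth.
Variables (R : realType) (a : nat -> R).
Hypothesis Ka : classK a.
Hypothesis entire_a : entire a.
Local Notation f t := (limn (pseries a t)).

Lemma powR_negligible (C d sg : R) Q : 0 < sg -> sg < Q%:R -> 0 < d ->
  exists2 T, 1 <= T & forall t, T <= t -> C * t `^ sg <= d * t ^+ Q.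
Proof.
move=> sg0 sgQ d0; pose p := Q%:R - sg; have p0 : 0 < p by rewrite subr_gt0.
pose X := `|C| / d; have X0 : 0 <= X by rewrite divr_ge0// ltW.
exists (Num.max 1 (X `^ p^-1)); first by rewrite le_max lexx.
move=> t; rewrite ge_max => /andP[t1 tX].
have t0 := lt_le_trans ltr01 t1.
have tp : X <= t `^ p.
  apply: (@le_trans _ _ ((X `^ p^-1) `^ p)).
    by rewrite -powRrM mulVf ?gt_eqF// powRr1.
  by rewrite ge0_ler_powR// ?nnegrE ?powR_ge0 ?ltW.
have -> : t ^+ Q = t `^ sg * t `^ p.
  rewrite -powRD; last by rewrite (gt_eqF t0) implybT.
  by rewrite addrC subrK powR_mulrn// ltW.
apply: (@le_trans _ _ (`|C| * t `^ sg)).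
  by rewrite ler_wpM2r ?powR_ge0// ler_norm.
rewrite mulrCA mulrC ler_wpM2l ?powR_ge0//.
by rewrite -ler_pdivrMl// mulrC.
Qed.

Lemma bernoulli_1B (e : R) Q : 0 <= e <= 1 -> 1 - Q%:R * e <= (1 - e) ^+ Q.
Proof.
move=> /andP[e0 e1]; elim: Q => [|Q IH]; first by rewrite mul0r subr0 expr0.
have e1' : 0 <= 1 - e by rewrite subr_ge0.
rewrite exprS; apply: le_trans (ler_wpM2l e1' IH).
by rewrite -natr1; have := mulr_ge0 (ler0n R Q) (sqr_ge0 e); lra.
Qed.

Lemma expR_le_quadratic (x : R) : `|x| <= 2^-1 -> expR x <= 1 + x + 2 * x ^+ 2.
Proof.
rewrite ler_norml => /andP[x1 x2].
have x0 : 0 < 1 - x by lra.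
apply: (@le_trans _ _ (1 - x)^-1).
  rewrite -[x in expR x]opprK expRN lef_pV2 ?posrE ?expR_gt0//.
  exact: expR_ge1Dx.
rewrite -[leLHS]mul1r ler_pdivrMr//.
have x12 : 0 <= 1 - 2 * x by lra.
by have := mulr_ge0 (sqr_ge0 x) x12; lra.
Qed.

(** Chernoff's bound in pointwise form, which bounds the second moment without integrating tails.
    For [v > eta] it follows from [v^2 <= 4 e^v] and [v <= 1 + lam (v - eta)]. *)
Lemma sqr_le_exp (u eta lam : R) : 0 < eta -> eta <= 1 -> 1 <= lam ->
  u ^+ 2 <= eta ^+ 2 +
    4 * expR 1 * (expR (lam * (u - eta)) + expR (- lam * (u + eta))).
Proof.
move=> eta0 eta1 lam1.
have sq (v : R) : 0 <= v -> v ^+ 2 <= 4 * expR v.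
  move=> v0; have -> : expR v = expR (v / 2) ^+ 2.
    by rewrite -expRM_natl mulrC divfK.
  have : 1 + v / 2 <= expR (v / 2) by exact: expR_ge1Dx.
  have -> : v ^+ 2 = 4 * (v / 2) ^+ 2 by field.
  move=> le1; rewrite ler_pM2l// lerXn2r ?nnegrE ?divr_ge0 ?expR_ge0//.
  by apply: le_trans le1; rewrite lerDr.
have big (v : R) : eta < v -> v ^+ 2 <= 4 * expR 1 * expR (lam * (v - eta)).
  move=> ev; rewrite (le_trans (sq v _))//; first by rewrite ltW// (lt_trans eta0).
  rewrite -mulrA ler_pM2l// -expRD ler_expR.
  have : 0 <= (lam - 1) * (v - eta) by rewrite mulr_ge0// subr_ge0// ltW.
  by lra.
have c0 : 0 <= 4 * expR (1 : R) by rewrite mulr_ge0// expR_ge0.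
have p1 := mulr_ge0 c0 (expR_ge0 (lam * (u - eta))).
have p2 := mulr_ge0 c0 (expR_ge0 (- lam * (u + eta))).
have s0 := sqr_ge0 eta; rewrite mulrDr.
have [u1|u1] := ltP eta u; first by have := big _ u1; lra.
have [u2|u2] := ltP eta (- u).
  have := big _ u2; rewrite sqrrN.
  have -> : lam * (- u - eta) = - lam * (u + eta) by ring.
  by lra.
have : u ^+ 2 <= eta ^+ 2.
  rewrite -[leLHS]real_normK ?num_real// lerXn2r ?nnegrE ?(ltW eta0)//.
  by rewrite ler_norml lerNl u2 u1.
lra.
Qed.

Variables (A sg T : R) (Q : nat).
Hypothesis A0 : 0 < A.
Hypothesis sg0 : 0 < sg.
Hypothesis sgQ : sg < Q%:R.
Hypothesis T1 : 1 <= T.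
Hypothesis fA : regular_growth a A sg Q T.

Let Q0 : (0 < Q)%N. Proof. by rewrite -(ltr_nat R) (lt_trans sg0). Qed.

Lemma regular_growth_eps (d : R) : 0 < d -> exists2 T', 1 <= T' &
  forall t, T' <= t -> (A - d) * t ^+ Q <= ln (f t) /\ ln (f t) <= (A + d) * t ^+ Q.
Proof.
move=> d0; have [[C1 C1P] lo] := fA.
have [T1' T11 T1P] := powR_negligible C1 sg0 sgQ d0.
have Q0' : 0 < Q%:R :> R by rewrite ltr0n.
(* By Bernoulli's inequality the factor [(1 - e)^Q] costs at most [A Q e <= d / 2]; the other half
   of [d] absorbs the term in [t^sg]. *)
pose e := Num.min 2^-1 (d / (2 * A * Q%:R)).
have AQ0 : 0 < 2 * A * Q%:R by rewrite !mulr_gt0.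
have e0 : 0 < e by rewrite lt_min invr_gt0 ltr0n/= divr_gt0.
have e2 : e <= 2^-1 by rewrite ge_min lexx.
have ed : A * (Q%:R * e) <= d / 2.
  have : e <= d / (2 * A * Q%:R) by rewrite ge_min lexx orbT.
  by rewrite ler_pdivlMr// => ?; lra.
have e1 : e < 1 by lra.
have [C2 C2P] := lo e e0 e1.
have d20 : 0 < d / 2 by rewrite divr_gt0.
have [T2' T21 T2P] := powR_negligible C2 sg0 sgQ d20.
exists (Num.max T (Num.max T1' T2')); first by rewrite le_max T1.
move=> t; rewrite !ge_max => /andP[tT /andP[t1 t2]].
have tgt0 : 0 < t ^+ Q.
  by rewrite exprn_gt0// (lt_le_trans ltr01)// (le_trans T11).
split; last first.
  by have := C1P t tT; have := T1P t t1; rewrite mulrDl; lra.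
have := C2P t tT; have := T2P t t2; rewrite exprMn mulrA.
have be : A * (1 - Q%:R * e) <= A * (1 - e) ^+ Q.
  by rewrite ler_pM2l// bernoulli_1B// (ltW e0)/=; lra.
have := ler_wpM2r (ltW tgt0) be.
have := ler_wpM2r (ltW tgt0) ed.
move: (A * (1 - e) ^+ Q * t ^+ Q) (C2 * _) (t ^+ Q) => p q r; lra.
Qed.

(* [x] is [+- eta / 4]; the exponent is negative since [expR x - 1 - x] is
   quadratic in [x]. *)
Lemma chernoff_bound (eta x : R) : 0 < eta -> eta <= 1 -> `|x| = eta / 4 ->
  exists2 T', 1 <= T' & forall t, T' <= t ->
  (expectation (khinchin_law a t) (fun n : nat =>
     expR (x / Q%:R * n%:R - x * A * t ^+ Q - eta / 4 * eta * A * t ^+ Q))%R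
   <= (expR (- (A * eta ^+ 2 / 16 * t ^+ Q)))%:E)%E.
Proof.
move=> eta0 eta1 xeta.
(* In units of [A t^Q], the exponent gains [eta^2 / 4] and loses [eta^2 / 8] to the quadratic part
   of [expR x]. The two growth errors cost at most [3 d t^Q], as [expR x <= 2]; this [d] leaves
   [eta^2 / 16]. *)
pose d := A * eta ^+ 2 / 48.
have d0 : 0 < d by rewrite divr_gt0// mulr_gt0// exprn_gt0.
have [T' T'1 T'P] := regular_growth_eps d0.
(* With this [h], [(t e^h)^Q = t^Q e^x]. The threshold is enlarged by [expR |h|] so that the growth
   bounds hold at [t] and at [t e^h]. *)
pose h := x / Q%:R.
exists (T' * expR `|h|) => [|t tT].
  by rewrite mulr_ege1// -expR0 ler_expR.
have t1 : T' <= t.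
  apply: le_trans tT; rewrite ler_peMr ?(le_trans ler01)//.
  by rewrite -expR0 ler_expR.
have tgt0 : 0 < t := lt_le_trans ltr01 (le_trans T'1 t1).
have th : T' <= t * expR h.
  rewrite -ler_pdivrMr ?expR_gt0// -expRN (le_trans _ tT)//.
  rewrite ler_pM2l ?(lt_le_trans ltr01)// ler_expR.
  by rewrite (le_trans (ler_norm _))// normrN.
have th0 : 0 < t * expR h by rewrite mulr_gt0// expR_gt0.
pose c := - (x * A * t ^+ Q + eta / 4 * eta * A * t ^+ Q).
rewrite (_ : (fun n : nat => _) =
  (fun n : nat => expR c * expR (h * n%:R)))%R; last first.
  by apply/funext => n; rewrite -expRD /c /h; congr expR; ring.
rewrite khinchin_expectationZ ?expR_ge0//.
rewrite khinchin_expectation_exp// -EFinM lee_fin.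
have f1 := pseries_gt0 Ka entire_a (ltW tgt0).
have f2 := pseries_gt0 Ka entire_a (ltW th0).
rewrite -[X in expR c * (X / _)]lnK ?posrE// -[X in _ / X]lnK ?posrE//.
rewrite -expRB -expRD ler_expR.
have [lo _] := T'P t t1; have [_ hi] := T'P _ th.
have hQ : expR h ^+ Q = expR x.
  by rewrite -expRM_natl /h mulrC divfK// pnatr_eq0 -lt0n.
rewrite exprMn hQ in hi.
have x2 : x ^+ 2 = eta ^+ 2 / 16.
  by rewrite -[LHS]real_normK ?num_real// xeta; field.
have xq : expR x <= 1 + x + eta ^+ 2 / 8.
  have x12 : `|x| <= 2^-1 by rewrite xeta; lra.
  by have := expR_le_quadratic x12; rewrite x2; lra.
have x14 : x <= 1 / 4 by have := ler_norm x; rewrite xeta; lra.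
have ex2 : expR x <= 2.
  have : eta ^+ 2 <= 1 by rewrite exprn_ile1// ltW.
  lra.
have tQ0 : 0 < t ^+ Q by rewrite exprn_gt0.
have AtQ0 : 0 <= A * t ^+ Q by rewrite mulr_ge0// ltW.
have dtQ0 : 0 <= d * t ^+ Q by rewrite mulr_ge0// ltW.
have l1 := ler_wpM2l AtQ0 xq.
have l2 := ler_wpM2l dtQ0 ex2.
have dE : d * t ^+ Q = A * t ^+ Q * eta ^+ 2 / 48 by rewrite /d; field.
have cE : c = - (x * (A * t ^+ Q)) - eta ^+ 2 / 4 * (A * t ^+ Q).
  by rewrite /c; field.
have hi' : ln (f (t * expR h)) <= A * t ^+ Q * expR x + d * t ^+ Q * expR x.
  by rewrite (le_trans hi)// le_eqVlt; apply/orP; left; apply/eqP; ring.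
have lo' : A * t ^+ Q - d * t ^+ Q <= ln (f t) by rewrite -mulrBl.
have -> : A * eta ^+ 2 / 16 * t ^+ Q = A * t ^+ Q * eta ^+ 2 / 16 by field.
rewrite cE; move: l1 l2 hi' lo'; rewrite dE.
move: (A * t ^+ Q) (expR x) (ln _) (ln _) => B ex L1 L2.
lra.
Qed.

Lemma khinchin_moment_small (e : R) : 0 < e -> e <= 2^-1 ->
  exists2 T', 1 <= T' & forall t, T' <= t ->
  (expectation (khinchin_law a t) (fun n : nat =>
     ((n%:R - Q%:R * A * t ^+ Q) / (Q%:R * A * t ^+ Q)) ^+ 2 : R)%R
   <= (e ^+ 2)%:E)%E.
Proof.
move=> e0 e2; pose B : R := 4 * expR 1.
have B0 : 0 < B by rewrite mulr_gt0// expR_gt0.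
have Q0' : 0 < Q%:R :> R by rewrite ltr0n.
have B1 : 1 <= 1 + 2 * B by lra.
(* The final bound is [eta^2 (1 + 2 B) = e eta], which is at most [e^2]. *)
pose eta := e / (1 + 2 * B).
have eta0 : 0 < eta by rewrite divr_gt0//; lra.
have eta_e : eta <= e by rewrite ler_pdivrMr ?ler_peMr ?(ltW e0)//; lra.
have eta1 : eta <= 1 by lra.
have x1 : `|eta / 4| = eta / 4 by rewrite ger0_norm// divr_ge0// ltW.
have x2 : `|- (eta / 4)| = eta / 4 by rewrite normrN.
have [Ta Ta1 TaP] := chernoff_bound eta0 eta1 x1.
have [Tb Tb1 TbP] := chernoff_bound eta0 eta1 x2.
pose c := A * eta ^+ 2 / 16.
have c0 : 0 < c by rewrite divr_gt0// mulr_gt0// exprn_gt0.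
have lam0 : 0 < eta / 4 * A by rewrite mulr_gt0// divr_gt0.
(* The last two thresholds, used with [t <= t ^+ Q], make [lam] at least 1 and the Chernoff bound at
   most [eta ^+ 2]. *)
exists (Num.max (Num.max Ta Tb) (Num.max ((eta / 4 * A)^-1) (- ln (eta ^+ 2) / c))).
  by rewrite !le_max Ta1.
move=> t; rewrite !ge_max => /andP[/andP[ta tb] /andP[tl tc]].
have t1 := le_trans Ta1 ta; have t0 := lt_le_trans ltr01 t1.
have tQ : t <= t ^+ Q by rewrite -[leLHS]expr1 ler_weXn2l.
have small : expR (- (c * t ^+ Q)) <= eta ^+ 2.
  rewrite -[leRHS]lnK ?posrE ?exprn_gt0// ler_expR lerNl mulrC.
  by rewrite -ler_pdivrMr// (le_trans tc).
pose lam := eta / 4 * A * t ^+ Q.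
have lam1 : 1 <= lam.
  rewrite /lam -ler_pdivrMl// mulr1; exact: le_trans tQ.
set y := Q%:R * A * t ^+ Q.
have tQ0 : 0 < t ^+ Q by rewrite exprn_gt0.
have y0 : 0 < y by rewrite !mulr_gt0.
have eta2 : eta ^+ 2 + B * (eta ^+ 2 + 1 * eta ^+ 2) <= e ^+ 2.
  have -> : eta ^+ 2 + B * (eta ^+ 2 + 1 * eta ^+ 2) = (1 + 2 * B) * eta * eta by ring.
  have -> : (1 + 2 * B) * eta = e.
    by rewrite /eta mulrC divfK// gt_eqF// (lt_le_trans ltr01).
  by rewrite expr2 ler_pM2l.
pose g1 (n : nat) := expR (eta / 4 / Q%:R * n%:R - eta / 4 * A * t ^+ Q -
  eta / 4 * eta * A * t ^+ Q).
pose g2 (n : nat) := expR (- (eta / 4) / Q%:R * n%:R - - (eta / 4) * A * t ^+ Q -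
  eta / 4 * eta * A * t ^+ Q).
apply: (@le_trans _ _ (expectation (khinchin_law a t)
  (fun n => eta ^+ 2 + B * (g1 n + 1 * g2 n))%R)).
  apply: khinchin_expectation_le => // n; first exact: sqr_ge0.
  apply: le_trans (sqr_le_exp _ eta0 eta1 lam1) _.
  rewrite le_eqVlt; apply/orP; left; apply/eqP; congr (_ + _ * _).
  rewrite mul1r /g1 /g2 /lam /y; congr (expR _ + expR _).
    by field; rewrite !gt_eqF.
  by field; rewrite !gt_eqF.
apply: (@le_trans _ _ (eta ^+ 2 + B * (eta ^+ 2 + 1 * eta ^+ 2))%:E); last first.
  by rewrite lee_fin.
have g10 n : 0 <= g1 n by exact: expR_ge0.
have g20 n : 0 <= g2 n by exact: expR_ge0.
apply: (@khinchin_expectation_comb_le _ _ _ Ka entire_a t0 (fun=> eta ^+ 2)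
  (fun n => g1 n + 1 * g2 n)) => //.
- exact: ltW.
- by move=> n; exact: sqr_ge0.
- by move=> n; rewrite addr_ge0 ?mul1r.
- by rewrite khinchin_expectation_cst.
apply: khinchin_expectation_comb_le => //.
- by rewrite (le_trans (TaP t ta))// lee_fin.
- by rewrite (le_trans (TbP t tb))// lee_fin.
Qed.

Lemma regular_growth_clan : clan a.
Proof.
apply/cvgrPdist_lt => e e0.
pose e' := Num.min 2^-1 (e / 8).
have e'0 : 0 < e' by rewrite lt_min invr_gt0 ltr0n/= divr_gt0.
have e'2 : e' <= 2^-1 by rewrite ge_min lexx.
have e'e : e' <= e / 8 by rewrite ge_min lexx orbT.
have [T' T'1 T'P] := khinchin_moment_small e'0 e'2.
exists T'; split; [exact: num_real|move=> t /ltW tT].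
have t0 := lt_le_trans ltr01 (le_trans T'1 tT).
have y0 : 0 < Q%:R * A * t ^+ Q by rewrite !mulr_gt0 ?exprn_gt0// ltr0n.
have := khinchin_std_mean_le Ka entire_a t0 y0 e'0 e'2 (T'P t tT).
move=> le4; rewrite sub0r normrN ger0_norm; first by lra.
rewrite divr_ge0 ?sqrtr_ge0// fine_ge0//.
by apply: expectation_ge0 => n; exact: ler0n.
Qed.

End clan_of_regular_growth.

Theorem theorem2p5p10 (R : realType) (a : nat -> R) (Ka : classK a)
  (entire_a : entire a) (finite_order : (growth_order (psum a) < +oo)%E)
  (exceptional : exists b : cplx R, borel_exceptional (psum a) b) :
  clan a.
Proof.
have [b b_exc] := exceptional.
have [A [sg [Q [T [A0 sg0 sgQ T1 fA]]]]] :=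
  exceptional_regular_growth Ka entire_a finite_order b_exc.
exact: (regular_growth_clan Ka entire_a A0 sg0 sgQ T1 fA).
Qed.
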